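(* Let $L\in\mathcal{L}$ be such that $L$ and $L^*$ have order continuous norms. Let $\{A_{ij}\}_{i=1,\dots,k;\ j=1,\dots,m}$ be nonnegative matrices that define operators on $L$ and let $\alpha_1,\dots,\alpha_m$ be positive numbers with $\sum_{j=1}^m\alpha_j\ge1$. Put $$A=\left(A_{11}^{(\alpha_1)}\circ\cdots\circ A_{1m}^{(\alpha_m)}\right)\cdots\left(A_{k1}^{(\alpha_1)}\circ\cdots\circ A_{km}^{(\alpha_m)}\right).$$ Then $$\gamma(A)\le\gamma\left((A_{11}\cdots A_{k1})^{(\alpha_1)}\circ\cdots\circ(A_{1m}\cdots A_{km})^{(\alpha_m)}\right)\le\gamma(A_{11}\cdots A_{k1})^{\alpha_1}\cdots\gamma(A_{1m}\cdots A_{km})^{\alpha_m}$$ and $$\rho_{ess}(A)\le\rho_{ess}\left((A_{11}\cdots A_{k1})^{(\alpha_1)}\circ\cdots\circ(A_{1m}\cdots A_{km})^{(\alpha_m)}\right)\le\rho_{ess}(A_{11}\cdots A_{k1})^{\alpha_1}\cdots\rho_{ess}(A_{1m}\cdots A_{km})^{\alpha_m}.$$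
   Context: Let $R=\mathbb{N}$ or $R=\{1,\dots,N\}$. A Banach sequence space is a Banach space $L$ of complex sequences indexed by $R$ such that if $x$ is a complex sequence, $y\in L$ and $|x|\le|y|$ entrywise, then $x\in L$ and $\|x\|_L\le\|y\|_L$. $\mathcal{L}$ is the class of Banach sequence spaces containing every standard unit vector $e_n$ with $\|e_n\|_L=1$. A Banach lattice has order continuous norm if every decreasing net $0\le f_\alpha\downarrow0$ satisfies $\|f_\alpha\|\to0$; $L^*$ is the Banach dual of $L$. A nonnegative matrix $A=[a_{ij}]_{i,j\in R}$ defines an operator on $L$ if for every $x\in L$ the sums $(Ax)_i=\sum_j a_{ij}x_j$ converge absolutely and $Ax\in L$. Hadamard power: $A^{(t)}=[a_{ij}^t]$; Hadamard product: $A\circ B=[a_{ij}b_{ij}]$; matrix products are ordinary products. (It is known that for $\sum\alpha_j\ge1$ all matrices above define operators on $L$.) $\gamma(T)=\inf\{\delta>0: T(D_L)\subseteq M+\delta D_L\text{ for some finite }M\subset L\}$ is the Hausdorff measure of noncompactness ($D_L$ the closed unit ball), and $\rho_{ess}(T)$ is the essential spectral radius (spectral radius of the image of $T$ in the Calkin algebra). *)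

(* Defs.v *)
From Stdlib Require Import Reals Lra List.
From Coquelicot Require Import Coquelicot.
Open Scope R_scope.

(** Complex sequences indexed by nat.  The index set R of the paper is
    {0,...,n-1} (when [N = Some n]) or all of nat (when [N = None]). *)
Definition seqC := nat -> C.

Definition domb (N : option nat) (i : nat) : bool :=
  match N with None => true | Some n => Nat.ltb i n end.

Definition szero : seqC := fun _ => RtoC 0.
Definition sadd (x y : seqC) : seqC := fun i => Cplus (x i) (y i).
Definition ssub (x y : seqC) : seqC := fun i => Cminus (x i) (y i).
Definition sscal (c : C) (x : seqC) : seqC := fun i => Cmult c (x i).
Definition unitvec (n : nat) : seqC := fun i => if Nat.eqb i n then RtoC 1 else RtoC 0.

Definition is_BSS (N : option nat) (inL : seqC -> Prop) (nrm : seqC -> R) : Prop :=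
  (* sequences are indexed by R: they vanish outside R *)
  (forall x, inL x -> forall i, domb N i = false -> x i = RtoC 0) /\
  inL szero /\
  (forall x y, inL x -> inL y -> inL (sadd x y)) /\
  (forall c x, inL x -> inL (sscal c x)) /\
  (forall x, inL x -> 0 <= nrm x) /\
  (forall x, inL x -> nrm x = 0 -> forall i, x i = RtoC 0) /\
  (forall c x, inL x -> nrm (sscal c x) = Cmod c * nrm x) /\
  (forall x y, inL x -> inL y -> nrm (sadd x y) <= nrm x + nrm y) /\
  (forall u : nat -> seqC, (forall n, inL (u n)) ->
     (forall eps, 0 < eps -> exists n0, forall p q, (n0 <= p)%nat -> (n0 <= q)%nat ->
         nrm (ssub (u p) (u q)) < eps) ->
     exists x, inL x /\ forall eps, 0 < eps -> exists n0, forall n, (n0 <= n)%nat ->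
         nrm (ssub (u n) x) < eps) /\
  (forall x y, inL y -> (forall i, Cmod (x i) <= Cmod (y i)) -> inL x /\ nrm x <= nrm y).

Definition in_class_L (N : option nat) (inL : seqC -> Prop) (nrm : seqC -> R) : Prop :=
  is_BSS N inL nrm /\
  (forall n, domb N n = true -> inL (unitvec n) /\ nrm (unitvec n) = 1).

Definition realseq (x : seqC) : Prop := forall i, Im (x i) = 0.
Definition nonnegseq (x : seqC) : Prop := forall i, Im (x i) = 0 /\ 0 <= Re (x i).
Definition le_seq (x y : seqC) : Prop := forall i, Re (x i) <= Re (y i).

Definition directed {D : Type} (leD : D -> D -> Prop) : Prop :=
  inhabited D /\ (forall a, leD a a) /\
  (forall a b c, leD a b -> leD b c -> leD a c) /\
  (forall a b, exists c, leD a c /\ leD b c).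

Definition order_continuous_L (inL : seqC -> Prop) (nrm : seqC -> R) : Prop :=
  forall (D : Type) (leD : D -> D -> Prop) (f : D -> seqC),
    directed leD ->
    (forall a, inL (f a) /\ nonnegseq (f a)) ->
    (forall a b, leD a b -> le_seq (f b) (f a)) ->
    (forall g, inL g -> realseq g -> (forall a, le_seq g (f a)) -> le_seq g szero) ->
    forall eps, 0 < eps -> exists a0, forall a, leD a0 a -> nrm (f a) < eps.

Definition is_dual (inL : seqC -> Prop) (nrm : seqC -> R) (phi : seqC -> C) : Prop :=
  (forall x y, inL x -> inL y -> phi (sadd x y) = Cplus (phi x) (phi y)) /\
  (forall c x, inL x -> phi (sscal c x) = Cmult c (phi x)) /\
  (exists M, forall x, inL x -> Cmod (phi x) <= M * nrm x).

Definition dual_norm (inL : seqC -> Prop) (nrm : seqC -> R) (phi : seqC -> C) : R :=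
  real (Lub_Rbar (fun r => exists x, inL x /\ nrm x <= 1 /\ r = Cmod (phi x))).

Definition dzero : seqC -> C := fun _ => RtoC 0.
Definition dpositive (inL : seqC -> Prop) (phi : seqC -> C) : Prop :=
  forall x, inL x -> nonnegseq x -> Im (phi x) = 0 /\ 0 <= Re (phi x).
Definition dreal (inL : seqC -> Prop) (phi : seqC -> C) : Prop :=
  forall x, inL x -> realseq x -> Im (phi x) = 0.
Definition dle (inL : seqC -> Prop) (phi psi : seqC -> C) : Prop :=
  forall x, inL x -> nonnegseq x -> Re (phi x) <= Re (psi x).

Definition order_continuous_dual (inL : seqC -> Prop) (nrm : seqC -> R) : Prop :=
  forall (D : Type) (leD : D -> D -> Prop) (f : D -> (seqC -> C)),
    directed leD ->
    (forall a, is_dual inL nrm (f a) /\ dpositive inL (f a)) ->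
    (forall a b, leD a b -> dle inL (f b) (f a)) ->
    (forall g, is_dual inL nrm g -> dreal inL g -> (forall a, dle inL g (f a)) ->
       dle inL g dzero) ->
    forall eps, 0 < eps -> exists a0, forall a, leD a0 a -> dual_norm inL nrm (f a) < eps.

Definition is_bop (inL : seqC -> Prop) (nrm : seqC -> R) (T : seqC -> seqC) : Prop :=
  (forall x, inL x -> inL (T x)) /\
  (forall x y, inL x -> inL y -> forall i, T (sadd x y) i = sadd (T x) (T y) i) /\
  (forall c x, inL x -> forall i, T (sscal c x) i = sscal c (T x) i) /\
  (exists M, forall x, inL x -> nrm (T x) <= M * nrm x).

Definition covers (inL : seqC -> Prop) (nrm : seqC -> R) (T : seqC -> seqC)
    (delta : R) (Ms : list seqC) : Prop :=
  (forall y, In y Ms -> inL y) /\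
  forall x, inL x -> nrm x <= 1 -> exists y, In y Ms /\ nrm (ssub (T x) y) <= delta.

Definition is_compact_op (inL : seqC -> Prop) (nrm : seqC -> R) (T : seqC -> seqC) : Prop :=
  is_bop inL nrm T /\
  forall delta, 0 < delta -> exists Ms, covers inL nrm T delta Ms.

Definition hnc (inL : seqC -> Prop) (nrm : seqC -> R) (T : seqC -> seqC) : R :=
  real (Glb_Rbar (fun delta => 0 < delta /\ exists Ms, covers inL nrm T delta Ms)).

(** lam - T is NOT invertible in the Calkin algebra B(L)/K(L) *)
Definition in_ess_spectrum (inL : seqC -> Prop) (nrm : seqC -> R) (T : seqC -> seqC)
    (lam : C) : Prop :=
  ~ exists S, is_bop inL nrm S /\
      is_compact_op inL nrm (fun x => ssub (S (ssub (sscal lam x) (T x))) x) /\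
      is_compact_op inL nrm (fun x => ssub (ssub (sscal lam (S x)) (T (S x))) x).

(** spectral radius of the Calkin image (0 if the spectrum is empty) *)
Definition rho_ess (inL : seqC -> Prop) (nrm : seqC -> R) (T : seqC -> seqC) : R :=
  real (Lub_Rbar (fun r => r = 0 \/ exists lam, in_ess_spectrum inL nrm T lam /\ r = Cmod lam)).

(** Matrices indexed by nat x nat (only entries indexed by R x R matter). *)
Definition mat := nat -> nat -> R.

Definition nonneg_mat (N : option nat) (A : mat) : Prop :=
  forall i j, domb N i = true -> domb N j = true -> 0 <= A i j.

Definition mat_app (N : option nat) (A : mat) (x : seqC) : seqC :=
  fun i => if domb N i
           then (Series (fun j => A i j * Re (x j)), Series (fun j => A i j * Im (x j)))
           else RtoC 0.

Definition defines_op (N : option nat) (inL : seqC -> Prop) (A : mat) : Prop :=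
  forall x, inL x ->
    (forall i, domb N i = true -> ex_series (fun j => A i j * Cmod (x j))) /\
    inL (mat_app N A x).

Definition mat_mul (N : option nat) (A B : mat) : mat :=
  fun i j => Series (fun l => if domb N l then A i l * B l j else 0).

Definition mat_id : mat := fun i j => if Nat.eqb i j then 1 else 0.

Fixpoint mat_prod (N : option nat) (k : nat) (F : nat -> mat) : mat :=
  match k with
  | O => mat_id
  | S n => mat_mul N (mat_prod N n F) (F n)
  end.

(** a^t for a >= 0, t > 0 (with 0^t = 0) *)
Definition hpow (a t : R) : R := if Rle_dec a 0 then 0 else Rpower a t.

Fixpoint Rprod (n : nat) (f : nat -> R) : R :=
  match n with O => 1 | S n' => Rprod n' f * f n' end.
Fixpoint Rsum (n : nat) (f : nat -> R) : R :=
  match n with O => 0 | S n' => Rsum n' f + f n' end.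

Definition hadam (m : nat) (F : nat -> mat) (alpha : nat -> R) : mat :=
  fun i j => Rprod m (fun l => hpow (F l i j) (alpha l)).

(* Main.v *)
(** Let [Q_n] be the projection onto the coordinates from [n] on.  Order continuity of the norm
    of [L] gives [gamma(T) = lim |Q_n T|], so that [gamma] is monotone under domination
    [|T x| <= S |x|] and is the norm of the Calkin algebra.

    After scaling each matrix to norm at most 1 its entries are at most 1, and the weighted
    AM-GM inequality bounds the Hadamard product entrywise by a convex combination of the
    factors.  This gives the inequality for the norms, hence for [gamma] (apply it to the
    matrices [Q_n A_j]), and also the entrywise inequality between the product of Hadamard
    products and the Hadamard product of products.

    For the essential spectral radius, [rho_ess(T) = inf gamma(T^n)^(1/n)] for positive [T].
    The bound from above is a Neumann series modulo finite rank; the bound from below uses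
    positivity instead of complex analysis: the resolvent can not stay bounded at the infimum
    because the square of a geometric series has coefficients [n + 1].  The inequalities for
    [rho_ess] then follow from those for [gamma] applied to powers. *)
Require Import Defs.
From Stdlib Require Import Reals List Lra Lia Classical ClassicalEpsilon FunctionalExtensionality.
From Coquelicot Require Import Coquelicot.
Open Scope R_scope.

(** * Weighted AM-GM and series *)

(** The numbers to scale by (norms, measures of noncompactness, radii, sums of series) may be zero.
    Each inequality with a product of powers on the right is therefore proved for upper bounds [c j]
    that are positive. When the true quantities may vanish, the [c j] are taken strictly above them
    and lowered at the end by right continuity of [hpow], also at 0. The condition
    [1 <= Rsum m alpha] enters through one fact: a number in [0,1] does not decrease when its
    exponent is divided by a sum that is at least 1. That entries lie in [0,1] after scaling comes
    from unit vectors having norm 1. In the entrywise inequality for matrix products the sum of the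
    series of the products [F l i p * G l p j] takes the place of the norm. Domination of operators
    cannot be read off from finite nets, but norms respect it; this is why every comparison of
    measures of noncompactness passes through tails. *)

Lemma Rsum_ext m f g : (forall j, (j < m)%nat -> f j = g j) -> Rsum m f = Rsum m g.
Proof.
  induction m as [|m IH]; intros E; simpl; [reflexivity|].
  rewrite IH by (intros; apply E; lia). rewrite (E m) by lia. reflexivity.
Qed.

Lemma Rsum_le m f g : (forall j, (j < m)%nat -> f j <= g j) -> Rsum m f <= Rsum m g.
Proof.
  induction m as [|m IH]; intros E; simpl; [lra|].
  apply Rplus_le_compat; [apply IH; intros; apply E|apply E]; lia.
Qed.

Lemma Rsum_plus m f g : Rsum m (fun j => f j + g j) = Rsum m f + Rsum m g.
Proof. induction m as [|m IH]; simpl; [ring|]. rewrite IH. ring. Qed.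

Lemma Rsum_scal m c f : Rsum m (fun j => c * f j) = c * Rsum m f.
Proof. induction m as [|m IH]; simpl; [ring|]. rewrite IH. ring. Qed.

Lemma Rprod_ext m f g : (forall j, (j < m)%nat -> f j = g j) -> Rprod m f = Rprod m g.
Proof.
  induction m as [|m IH]; intros E; simpl; [reflexivity|].
  rewrite IH by (intros; apply E; lia). rewrite (E m) by lia. reflexivity.
Qed.

Lemma Rprod_nonneg m f : (forall j, (j < m)%nat -> 0 <= f j) -> 0 <= Rprod m f.
Proof.
  induction m as [|m IH]; intros E; simpl; [lra|].
  apply Rmult_le_pos; [apply IH; intros; apply E|apply E]; lia.
Qed.

Lemma Rprod_pos m f : (forall j, (j < m)%nat -> 0 < f j) -> 0 < Rprod m f.
Proof.
  induction m as [|m IH]; intros E; simpl; [lra|].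
  apply Rmult_lt_0_compat; [apply IH; intros; apply E|apply E]; lia.
Qed.

Lemma Rprod_lt m f g : (0 < m)%nat ->
  (forall j, (j < m)%nat -> 0 <= f j < g j) -> Rprod m f < Rprod m g.
Proof.
  intros Hm E. destruct m as [|m]; [lia|]. clear Hm.
  induction m as [|m IH]; [simpl; specialize (E 0%nat ltac:(lia)); lra|].
  change (Rprod (S m) f * f (S m) < Rprod (S m) g * g (S m)).
  assert (H1 : Rprod (S m) f < Rprod (S m) g) by (apply IH; intros; apply E; lia).
  assert (H2 : 0 <= Rprod (S m) f) by (apply Rprod_nonneg; intros; apply E; lia).
  specialize (E (S m) ltac:(lia)).
  apply Rmult_le_0_lt_compat; lra.
Qed.

Lemma Rprod_mult m f g : Rprod m (fun j => f j * g j) = Rprod m f * Rprod m g.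
Proof. induction m as [|m IH]; simpl; [ring|]. rewrite IH. ring. Qed.

Lemma Rprod_pow m f n : Rprod m (fun j => f j ^ n) = Rprod m f ^ n.
Proof.
  induction m as [|m IH]; simpl; [now rewrite pow1|].
  rewrite IH, Rpow_mult_distr. reflexivity.
Qed.

Lemma Rprod_eq0 m f j : (j < m)%nat -> f j = 0 -> Rprod m f = 0.
Proof.
  induction m as [|m IH]; intros Hj E; simpl; [lia|].
  destruct (Nat.eq_dec j m) as [->|]; [rewrite E; ring|].
  rewrite IH by (lia || assumption). ring.
Qed.

Lemma hpow_nonneg a t : 0 <= hpow a t.
Proof.
  unfold hpow. destruct (Rle_dec a 0); [lra|]. unfold Rpower. left; apply exp_pos.
Qed.

Lemma hpow_pos a t : 0 < a -> 0 < hpow a t.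
Proof. unfold hpow. destruct (Rle_dec a 0); [lra|]. intros _. apply exp_pos. Qed.

Lemma hpow_0 a t : a <= 0 -> hpow a t = 0.
Proof. unfold hpow. destruct (Rle_dec a 0); [easy|lra]. Qed.

Lemma hpow_1 t : hpow 1 t = 1.
Proof.
  unfold hpow. destruct (Rle_dec 1 0); [lra|]. unfold Rpower. rewrite ln_1, Rmult_0_r.
  apply exp_0.
Qed.

Lemma hpow_mult a b t : 0 <= a -> 0 <= b -> hpow (a * b) t = hpow a t * hpow b t.
Proof.
  intros Ha Hb. destruct Ha as [Ha|<-]; [|rewrite Rmult_0_l, hpow_0 by lra; ring].
  destruct Hb as [Hb|<-]; [|rewrite Rmult_0_r, (hpow_0 0) by lra; ring].
  assert (0 < a * b) by now apply Rmult_lt_0_compat.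
  unfold hpow. destruct (Rle_dec (a * b) 0); [lra|]. destruct (Rle_dec a 0); [lra|].
  destruct (Rle_dec b 0); [lra|]. now rewrite Rpower_mult_distr.
Qed.

Lemma hpow_pow a t n : 0 <= a -> hpow (a ^ n) t = hpow a t ^ n.
Proof.
  intros Ha. induction n as [|n IH]; simpl; [apply hpow_1|].
  rewrite hpow_mult by (trivial; now apply pow_le). now rewrite IH.
Qed.

Lemma hpow_lt a b t : 0 < t -> 0 <= a < b -> hpow a t < hpow b t.
Proof.
  intros Ht [Ha Hab]. destruct Ha as [Ha|<-].
  - unfold hpow. destruct (Rle_dec a 0); [lra|]. destruct (Rle_dec b 0); [lra|].
    apply exp_increasing, Rmult_lt_compat_l; [lra|]. now apply ln_increasing.
  - rewrite (hpow_0 0) by lra. apply hpow_pos. lra.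
Qed.

Lemma Rprod_hpow_exp m a t : (forall j, (j < m)%nat -> 0 < a j) ->
  Rprod m (fun j => hpow (a j) (t j)) = exp (Rsum m (fun j => t j * ln (a j))).
Proof.
  induction m as [|m IH]; intros E; simpl; [now rewrite exp_0|].
  rewrite IH by (intros; apply E; lia). rewrite exp_plus. f_equal.
  specialize (E m ltac:(lia)). unfold hpow. destruct (Rle_dec (a m) 0); [lra|easy].
Qed.

(* Jensen via the tangent line: [exp u >= exp v * (1 + u - v)], with [v] the mean. *)
Lemma exp_Rsum_convex m b u : (forall j, (j < m)%nat -> 0 <= b j) -> Rsum m b = 1 ->
  exp (Rsum m (fun j => b j * u j)) <= Rsum m (fun j => b j * exp (u j)).
Proof.
  intros Hb Hs. set (v := Rsum m (fun j => b j * u j)).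
  replace (exp v) with (Rsum m (fun j => exp v * (b j * (1 - v) + b j * u j))).
  - apply Rsum_le. intros j Hj.
    replace (exp v * (b j * (1 - v) + b j * u j))
      with (b j * (exp v * (1 + (u j - v)))) by ring.
    apply Rmult_le_compat_l; [now apply Hb|].
    replace (exp (u j)) with (exp v * exp (u j - v)) by (rewrite <- exp_plus; f_equal; ring).
    apply Rmult_le_compat_l; [left; apply exp_pos|apply exp_ineq1_le].
  - rewrite Rsum_scal, Rsum_plus. fold v.
    rewrite (Rsum_ext m (fun j => b j * (1 - v)) (fun j => (1 - v) * b j))
      by (intros; ring).
    rewrite Rsum_scal, Hs. ring.
Qed.

(* Since the arguments are at most 1, the exponents may be lowered until they sum to 1;
   what is left is the weighted AM-GM inequality. *)
Lemma weighted_amgm m t alpha :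
  (forall j, (j < m)%nat -> t j <= 1) -> (forall j, (j < m)%nat -> 0 <= t j) ->
  (forall j, (j < m)%nat -> 0 < alpha j) -> 1 <= Rsum m alpha ->
  Rprod m (fun j => hpow (t j) (alpha j))
    <= Rsum m (fun j => alpha j / Rsum m alpha * t j).
Proof.
  intros H1 H0 Ha Hs. set (s := Rsum m alpha) in *.
  assert (Hb : forall j, (j < m)%nat -> 0 <= alpha j / s).
  { intros j Hj. apply Rlt_le, Rdiv_lt_0_compat; [now apply Ha|lra]. }
  (* A vanishing factor makes the left side 0; otherwise logarithms are available. *)
  destruct (classic (exists j, (j < m)%nat /\ t j = 0)) as [[j [Hj E]]|Hpos].
  - rewrite (Rprod_eq0 m _ j Hj) by (apply hpow_0; lra).
    replace 0 with (Rsum m (fun j => 0 * 0)) by (rewrite Rsum_scal; ring).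
    apply Rsum_le. intros i Hi. rewrite Rmult_0_l. apply Rmult_le_pos; auto.
  - assert (Hp : forall j, (j < m)%nat -> 0 < t j).
    { intros j Hj. destruct (H0 j Hj) as [|E]; trivial. exfalso; apply Hpos. now exists j. }
    rewrite Rprod_hpow_exp by trivial.
    apply Rle_trans with (exp (Rsum m (fun j => alpha j / s * ln (t j)))).
    + assert (Hle : Rsum m (fun j => alpha j * ln (t j))
                    <= Rsum m (fun j => alpha j / s * ln (t j))).
      { apply Rsum_le. intros j Hj.
        assert (ln (t j) <= 0) by (rewrite <- ln_1; apply ln_le; auto).
        assert (alpha j / s <= alpha j).
        { apply (Rmult_le_reg_r s); [lra|]. unfold Rdiv. rewrite Rmult_assoc, Rinv_l by lra.
          apply Rmult_le_compat_l; [left; now apply Ha|lra]. }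
        nra. }
      destruct Hle as [Hlt|E]; [left; now apply exp_increasing|rewrite E; lra].
    + eapply Rle_trans; [apply exp_Rsum_convex; trivial|].
      * rewrite (Rsum_ext m _ (fun j => / s * alpha j)) by (intros; unfold Rdiv; ring).
        rewrite Rsum_scal. fold s. field. lra.
      * apply Rsum_le. intros j Hj. rewrite exp_ln by now apply Hp. lra.
Qed.

(** Apply [weighted_amgm] to the ratios [a j / c j] and multiply back by the product of the
    [hpow (c j) (alpha j)]. The bound is linear in [a] with coefficients that do not depend on [a],
    so it can be used with one choice of [c] for all entries of matrices or for all terms of series.
    At [a = c] its value is exactly that product, so nothing is lost in the constant. *)
Lemma hadamard_entry_le m a c alpha :
  (forall j, (j < m)%nat -> 0 <= a j <= c j) -> (forall j, (j < m)%nat -> 0 < c j) ->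
  (forall j, (j < m)%nat -> 0 < alpha j) -> 1 <= Rsum m alpha ->
  Rprod m (fun j => hpow (a j) (alpha j))
    <= Rsum m (fun j => Rprod m (fun j => hpow (c j) (alpha j))
                        * (alpha j / Rsum m alpha * / c j) * a j).
Proof.
  intros Hac Hc Ha Hs. set (K := Rprod m (fun j => hpow (c j) (alpha j))).
  rewrite (Rprod_ext m _ (fun j => hpow (c j) (alpha j) * hpow (a j / c j) (alpha j))).
  - rewrite Rprod_mult. fold K.
    rewrite (Rsum_ext m _ (fun j => K * (alpha j / Rsum m alpha * (a j / c j))))
      by (intros; unfold Rdiv; ring).
    rewrite Rsum_scal. apply Rmult_le_compat_l.
    + apply Rprod_nonneg. intros. apply hpow_nonneg.
    + apply weighted_amgm; trivial; intros j Hj; specialize (Hac j Hj); specialize (Hc j Hj).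
      * apply (Rmult_le_reg_r (c j)); [lra|]. unfold Rdiv. rewrite Rmult_assoc, Rinv_l; lra.
      * apply Rmult_le_pos; [lra|]. left; now apply Rinv_0_lt_compat.
  - intros j Hj. specialize (Hac j Hj); specialize (Hc j Hj).
    rewrite <- hpow_mult; [f_equal; field; lra|lra|].
    apply Rmult_le_pos; [lra|]. left; now apply Rinv_0_lt_compat.
Qed.

Lemma Rsum_pos_index m alpha : 1 <= Rsum m alpha -> (0 < m)%nat.
Proof. destruct m; simpl; [lra|lia]. Qed.

(** The point 0 needs its own argument, because [hpow] is defined by cases there and the logarithm
    is not continuous. *)
Lemma is_lim_seq_hpow a t : 0 <= a -> 0 < t ->
  is_lim_seq (fun n => hpow (a + / (INR n + 1)) t) (hpow a t).
Proof.
  intros Ha Ht.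
  assert (Hinv : is_lim_seq (fun n => / (INR n + 1)) 0).
  { apply (is_lim_seq_ext (fun n => / INR (S n))); [intros; now rewrite S_INR|].
    apply (is_lim_seq_incr_1 (fun n => / INR n)).
    replace (Finite 0) with (Rbar_inv p_infty) by reflexivity.
    apply is_lim_seq_inv; [apply is_lim_seq_INR|easy]. }
  assert (Hp : forall n, 0 < / (INR n + 1)).
  { intros n. apply Rinv_0_lt_compat. pose proof (pos_INR n). lra. }
  destruct Ha as [Ha|<-].
  - assert (E : forall x, 0 < x -> exp (t * ln x) = hpow x t).
    { intros x Hx. unfold hpow. now destruct (Rle_dec x 0); [lra|]. }
    rewrite <- (E a Ha).
    apply (is_lim_seq_ext (fun n => exp (t * ln (a + / (INR n + 1))))).
    { intros n. apply E. specialize (Hp n). lra. }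
    apply (is_lim_seq_continuous (fun x => exp (t * ln x))).
    + apply continuity_pt_filterlim.
      apply (ex_derive_continuous (V := R_NormedModule) (fun x => exp (t * ln x))).
      auto_derive. lra.
    + pose proof (is_lim_seq_plus' _ _ _ _ (is_lim_seq_const a) Hinv) as H.
      now rewrite Rplus_0_r in H.
  - rewrite (hpow_0 0) by lra. apply is_lim_seq_spec. intros [eps He]. simpl.
    (* The modulus of continuity at 0 is the number whose power with exponent [t] is [eps]. *)
    assert (Hd : 0 < hpow eps (/ t)) by now apply hpow_pos.
    apply is_lim_seq_spec in Hinv. destruct (Hinv (mkposreal _ Hd)) as [n0 Hn0].
    exists n0. intros n Hn. specialize (Hn0 n Hn). simpl in Hn0. specialize (Hp n).
    rewrite Rminus_0_r, Rabs_pos_eq in Hn0 by lra.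
    rewrite Rminus_0_r, Rabs_pos_eq, Rplus_0_l by apply hpow_nonneg.
    replace eps with (hpow (hpow eps (/ t)) t) at 1.
    + apply hpow_lt; lra.
    + unfold hpow. destruct (Rle_dec eps 0); [lra|].
      destruct (Rle_dec (Rpower eps (/ t)) 0) as [H|_].
      * exfalso. pose proof (exp_pos (/ t * ln eps)). unfold Rpower in H. lra.
      * rewrite Rpower_mult, Rinv_l, Rpower_1; lra.
Qed.

Lemma is_lim_seq_Rprod_hpow m a alpha :
  (forall j, (j < m)%nat -> 0 <= a j) -> (forall j, (j < m)%nat -> 0 < alpha j) ->
  is_lim_seq (fun n => Rprod m (fun j => hpow (a j + / (INR n + 1)) (alpha j)))
             (Rprod m (fun j => hpow (a j) (alpha j))).
Proof.
  induction m as [|m IH]; intros Ha Hal; simpl; [apply is_lim_seq_const|].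
  apply is_lim_seq_mult'.
  - apply IH; intros; [apply Ha|apply Hal]; lia.
  - apply is_lim_seq_hpow; [apply Ha|apply Hal]; lia.
Qed.

(** Replaces numbers that may be 0 by strictly larger ones, by which one can divide. *)
Lemma le_Rprod_hpow x m a alpha :
  (forall j, (j < m)%nat -> 0 <= a j) -> (forall j, (j < m)%nat -> 0 < alpha j) ->
  (forall c, (forall j, (j < m)%nat -> a j < c j) ->
     x <= Rprod m (fun j => hpow (c j) (alpha j))) ->
  x <= Rprod m (fun j => hpow (a j) (alpha j)).
Proof.
  intros Ha Hal H.
  apply (is_lim_seq_le (fun _ => x) _ x _)
    with (2 := is_lim_seq_const x) (3 := is_lim_seq_Rprod_hpow m a alpha Ha Hal).
  intros n. apply H. intros j Hj.
  assert (0 < / (INR n + 1)) by (apply Rinv_0_lt_compat; pose proof (pos_INR n); lra). lra.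
Qed.

Lemma pow_lt_compat a b n : 0 <= a < b -> (0 < n)%nat -> a ^ n < b ^ n.
Proof.
  intros Hab Hn. destruct n as [|n]; [lia|]. clear Hn.
  induction n as [|n IH]; [simpl; lra|].
  change (a * a ^ S n < b * b ^ S n). apply Rmult_le_0_lt_compat; trivial; [lra| |lra].
  apply pow_le; lra.
Qed.

(** * Termwise bounds for real and complex series *)

Lemma is_series_single (a : nat -> R) j :
  is_series (fun l => if Nat.eqb l j then a l else 0) (a j).
Proof.
  change (is_lim_seq (sum_n (fun l => if Nat.eqb l j then a l else 0)) (a j)).
  apply (is_lim_seq_ext_loc (fun _ => a j)); [|apply is_lim_seq_const].
  assert (H : forall n, sum_n (fun l => if Nat.eqb l j then a l else 0) n
                        = if Nat.leb j n then a j else 0).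
  { induction n as [|n IH].
    - rewrite sum_O. destruct j; reflexivity.
    - rewrite sum_Sn, IH.
      unfold plus.
      cbn [AbelianMonoid.plus AbelianMonoid.class R_AbelianMonoid AbelianMonoid.sort
           R_AbelianMonoid_mixin].
      destruct (Nat.eqb_spec (S n) j) as [<-|Hne].
      + rewrite (proj2 (Nat.leb_gt (S n) n)), (proj2 (Nat.leb_le (S n) (S n))) by lia. ring.
      + destruct (Nat.leb_spec j n), (Nat.leb_spec j (S n)); try lia; ring. }
  exists j. intros n Hn. rewrite H. now rewrite (proj2 (Nat.leb_le j n)).
Qed.

Lemma Series_zero : Series (fun _ => 0) = 0.
Proof.
  transitivity (0 * Series (fun _ => 0)); [|ring].
  rewrite <- Series_scal_l. apply Series_ext. intros; ring.
Qed.

Lemma term_le_Series a n : (forall l, 0 <= a l) -> ex_series a -> a n <= Series a.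
Proof.
  intros Ha Hex. rewrite <- (is_series_unique _ _ (is_series_single a n)).
  apply Series_le; trivial. intros l. specialize (Ha l). destruct (Nat.eqb l n); lra.
Qed.

Lemma is_series_Rsum m (a : nat -> nat -> R) s :
  (forall j, (j < m)%nat -> is_series (a j) (s j)) ->
  is_series (fun l => Rsum m (fun j => a j l)) (Rsum m s).
Proof.
  induction m as [|m IH]; intros H; simpl.
  - apply (is_series_ext (fun l => if Nat.eqb l 0 then 0 else 0)).
    + intros l. now destruct (Nat.eqb l 0).
    + apply (is_series_single (fun _ => 0) 0).
  - apply (is_series_plus (fun l => Rsum m (fun j => a j l)) (a m)); auto.
Qed.

(* Tested against the unit vector [(Series a, Series b) / s], the complex triangle inequality
   reduces to Cauchy-Schwarz in each term. *)
Lemma Cmod_Series_le a b c : ex_series a -> ex_series b -> ex_series c ->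
  (forall n, Cmod (a n, b n) <= c n) -> Cmod (Series a, Series b) <= Series c.
Proof.
  intros Ha Hb Hc H. set (s := Cmod (Series a, Series b)).
  assert (Hs2 : s ^ 2 = Series a ^ 2 + Series b ^ 2) by (unfold s; now rewrite Cmod2_alt).
  assert (Hs0 : 0 <= s) by apply Cmod_ge_0.
  assert (Hc0 : 0 <= Series c).
  { rewrite <- Series_zero. apply Series_le; trivial. intros n. split; [lra|].
    eapply Rle_trans; [apply Cmod_ge_0|apply H]. }
  destruct Hs0 as [Hs|<-]; trivial.
  apply (Rmult_le_reg_l s); trivial.
  replace (s * s) with (Series a * Series a + Series b * Series b) by (simpl in Hs2; lra).
  rewrite <- !Series_scal_l, <- Series_plus by now apply @ex_series_scal_l.
  apply Rle_trans with (Rabs (Series (fun n => Series a * a n + Series b * b n)));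
    [apply Rle_abs|].
  assert (Hterm : forall n, Rabs (Series a * a n + Series b * b n) <= s * c n).
  { intros n. apply Rle_trans with (s * Cmod (a n, b n));
      [|apply Rmult_le_compat_l; [lra|trivial]].
    assert (Hn : Cmod (a n, b n) ^ 2 = a n ^ 2 + b n ^ 2) by now rewrite Cmod2_alt.
    pose proof (Cmod_ge_0 (a n, b n)).
    rewrite <- (Rabs_pos_eq (s * _)) by (apply Rmult_le_pos; lra).
    apply Rsqr_le_abs_0. unfold Rsqr.
    replace (s * Cmod (a n, b n) * (s * Cmod (a n, b n)))
      with (s ^ 2 * Cmod (a n, b n) ^ 2) by ring.
    (* Lagrange's identity: the two sides differ by exactly this square. *)
    rewrite Hs2, Hn. pose proof (pow2_ge_0 (Series a * b n - Series b * a n)). lra. }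
  assert (Hsc : ex_series (fun n => s * c n)) by now apply @ex_series_scal_l.
  assert (Hex : ex_series (fun n => Rabs (Series a * a n + Series b * b n))).
  { apply (ex_series_le (V := R_CompleteNormedModule)) with (2 := Hsc).
    intros n. change (norm (Rabs (Series a * a n + Series b * b n)))
      with (Rabs (Rabs (Series a * a n + Series b * b n))). rewrite Rabs_Rabsolu. auto. }
  eapply Rle_trans; [now apply Series_Rabs|].
  apply Series_le; trivial. intros n. split; [apply Rabs_pos|auto].
Qed.

(** * Banach sequence spaces *)

Ltac seq_ring :=
  apply functional_extensionality; intros ?; unfold sadd, ssub, sscal, szero; try ring.

Lemma ssub_scal x y : ssub x y = sadd x (sscal (Copp 1) y).
Proof. seq_ring. Qed.

Lemma Cmod_le_fst_snd (z : C) : Cmod z <= Rabs (fst z) + Rabs (snd z).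
Proof.
  destruct z as [a b]. simpl. replace (a, b) with (Cplus (RtoC a) (Cmult Ci (RtoC b))).
  - eapply Rle_trans; [apply Cmod_triangle|]. rewrite Cmod_mult, !Cmod_R, Cmod_Ci. lra.
  - unfold Ci, Cplus, Cmult, RtoC. simpl. f_equal; ring.
Qed.

Lemma Rabs_snd_le_Cmod (z : C) : Rabs (snd z) <= Cmod z.
Proof. eapply Rle_trans; [apply Rmax_r|apply Rmax_Cmod]. Qed.

Definition sabs (x : seqC) : seqC := fun i => RtoC (Cmod (x i)).
Definition trunc (n : nat) (x : seqC) : seqC := fun i => if Nat.ltb i n then x i else RtoC 0.
Definition tail (n : nat) (x : seqC) : seqC := fun i => if Nat.ltb i n then RtoC 0 else x i.

(** Only the real part of [y] is read, and it is forced to be nonnegative. In particular [ldom x x]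
    says that [x] is a nonnegative real sequence, so positivity and domination need a single
    relation. *)
Definition ldom (x y : seqC) : Prop := forall i, Cmod (x i) <= Re (y i).

Lemma trunc_add_tail n x : x = sadd (trunc n x) (tail n x).
Proof. unfold trunc, tail. seq_ring. destruct (Nat.ltb x0 n); ring. Qed.

Lemma tail_add n x y : tail n (sadd x y) = sadd (tail n x) (tail n y).
Proof. unfold tail. seq_ring. destruct (Nat.ltb _ n); ring. Qed.

Lemma tail_sub n x y : tail n (ssub x y) = ssub (tail n x) (tail n y).
Proof. unfold tail. seq_ring. destruct (Nat.ltb _ n); ring. Qed.

Lemma tail_scal n c x : tail n (sscal c x) = sscal c (tail n x).
Proof. unfold tail. seq_ring. destruct (Nat.ltb _ n); ring. Qed.

Lemma trunc_S n x : trunc (S n) x = sadd (trunc n x) (sscal (x n) (unitvec n)).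
Proof.
  unfold trunc, unitvec. seq_ring.
  destruct (Nat.ltb_spec x0 (S n)), (Nat.ltb_spec x0 n), (Nat.eqb_spec x0 n); try lia;
    subst; ring.
Qed.

Lemma trunc_0 x : trunc 0 x = szero.
Proof. reflexivity. Qed.

Lemma ldom_sabs x : ldom x (sabs x).
Proof. intros i. unfold sabs. simpl. lra. Qed.

Lemma ldom_tail n x y : ldom x y -> ldom (tail n x) (tail n y).
Proof.
  intros H i. unfold tail. destruct (Nat.ltb i n); [rewrite Cmod_0; simpl; lra|apply H].
Qed.

Lemma ldom_add x y x' y' : ldom x y -> ldom x' y' -> ldom (sadd x x') (sadd y y').
Proof.
  intros H H' i. unfold sadd. eapply Rle_trans; [apply Cmod_triangle|].
  specialize (H i); specialize (H' i). simpl. unfold Re in *. lra.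
Qed.

Lemma Re_RtoC_mult a z : Re (Cmult (RtoC a) z) = a * Re z.
Proof. unfold Re, Cmult, RtoC. simpl. ring. Qed.

Lemma ldom_scal a b x y : 0 <= a <= b -> ldom x y ->
  ldom (sscal (RtoC a) x) (sscal (RtoC b) y).
Proof.
  intros H H' i. unfold sscal. rewrite Cmod_mult, Cmod_R, Re_RtoC_mult, Rabs_pos_eq by lra.
  specialize (H' i). pose proof (Cmod_ge_0 (x i)). apply Rmult_le_compat; lra.
Qed.

Lemma ldom_refl_nonneg x y : ldom x y -> forall i, 0 <= Re (y i).
Proof. intros H i. eapply Rle_trans; [apply Cmod_ge_0|apply H]. Qed.

Section BanachSequenceSpace.
Context (N : option nat) (inL : seqC -> Prop) (nrm : seqC -> R).
Context (HL : in_class_L N inL nrm).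

Lemma inL_out x i : inL x -> domb N i = false -> x i = RtoC 0.
Proof. destruct HL as [[H _] _]. auto. Qed.

Lemma inL_zero : inL szero.
Proof. apply HL. Qed.

Lemma inL_add x y : inL x -> inL y -> inL (sadd x y).
Proof. apply HL. Qed.

Lemma inL_scal c x : inL x -> inL (sscal c x).
Proof. apply HL. Qed.

Lemma inL_sub x y : inL x -> inL y -> inL (ssub x y).
Proof. intros. rewrite ssub_scal. auto using inL_add, inL_scal. Qed.

Lemma nrm_nonneg x : inL x -> 0 <= nrm x.
Proof. apply HL. Qed.

Lemma nrm_eq0 x : inL x -> nrm x = 0 -> x = szero.
Proof. intros H E. apply functional_extensionality. apply HL; trivial. Qed.

Lemma nrm_scal c x : inL x -> nrm (sscal c x) = Cmod c * nrm x.
Proof. apply HL. Qed.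

Lemma nrm_add x y : inL x -> inL y -> nrm (sadd x y) <= nrm x + nrm y.
Proof. apply HL. Qed.

Lemma nrm_zero : nrm szero = 0.
Proof.
  replace szero with (sscal 0 szero) by seq_ring.
  rewrite nrm_scal by apply inL_zero. rewrite Cmod_0. ring.
Qed.

Lemma nrm_sub x y : inL x -> inL y -> nrm (ssub x y) <= nrm x + nrm y.
Proof.
  intros. rewrite ssub_scal. eapply Rle_trans; [apply nrm_add; auto using inL_scal|].
  rewrite nrm_scal by trivial.
  rewrite Cmod_m1. lra.
Qed.

Lemma nrm_sub_sym x y : inL x -> inL y -> nrm (ssub x y) = nrm (ssub y x).
Proof.
  intros. replace (ssub x y) with (sscal (Copp 1) (ssub y x)) by seq_ring.
  rewrite nrm_scal by auto using inL_sub. rewrite Cmod_m1. ring.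
Qed.

Lemma ideal_Cmod x y : inL y -> (forall i, Cmod (x i) <= Cmod (y i)) ->
  inL x /\ nrm x <= nrm y.
Proof. apply HL. Qed.

Lemma ideal_ldom x y : inL y -> ldom x y -> inL x /\ nrm x <= nrm y.
Proof.
  intros Hy H. apply ideal_Cmod; trivial. intros i. specialize (H i).
  pose proof (re_le_Cmod (y i)). pose proof (Rle_abs (Re (y i))). lra.
Qed.

Lemma sabs_spec x : inL x -> inL (sabs x) /\ nrm (sabs x) = nrm x.
Proof.
  intros Hx. destruct (ideal_Cmod (sabs x) x Hx) as [H1 H2].
  { intros i. unfold sabs. rewrite Cmod_R, Rabs_pos_eq; [lra|apply Cmod_ge_0]. }
  split; trivial. apply Rle_antisym; trivial. now apply ideal_ldom, ldom_sabs.
Qed.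

Lemma tail_spec n x : inL x -> inL (tail n x) /\ nrm (tail n x) <= nrm x.
Proof.
  intros Hx. apply ideal_Cmod; trivial. intros i. unfold tail.
  destruct (Nat.ltb i n); [rewrite Cmod_0; apply Cmod_ge_0|lra].
Qed.

Lemma trunc_spec n x : inL x -> inL (trunc n x) /\ nrm (trunc n x) <= nrm x.
Proof.
  intros Hx. apply ideal_Cmod; trivial. intros i. unfold trunc.
  destruct (Nat.ltb i n); [lra|rewrite Cmod_0; apply Cmod_ge_0].
Qed.

Lemma tail_le n p x : inL x -> (n <= p)%nat -> nrm (tail p x) <= nrm (tail n x).
Proof.
  intros Hx Hnp. apply ideal_Cmod; [now apply tail_spec|]. intros i. unfold tail.
  destruct (Nat.ltb_spec i n), (Nat.ltb_spec i p); try lia; try lra.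
  rewrite Cmod_0; apply Cmod_ge_0.
Qed.

Lemma inL_unitvec n : domb N n = true -> inL (unitvec n).
Proof. intros; now apply HL. Qed.

Lemma nrm_unitvec n : domb N n = true -> nrm (unitvec n) = 1.
Proof. intros; now apply HL. Qed.

Lemma inL_coord_unitvec x n : inL x -> inL (sscal (x n) (unitvec n)).
Proof.
  intros Hx. destruct (domb N n) eqn:E.
  - now apply inL_scal, inL_unitvec.
  - rewrite (inL_out x n) by trivial. replace (sscal 0 (unitvec n)) with szero by seq_ring.
    apply inL_zero.
Qed.

(** The multiple [x i] of the unit vector is dominated by [x], and unit vectors have norm 1. Hence
    norm convergence implies coordinatewise convergence, and entries of a matrix are bounded by its
    norm. *)
Lemma coord_le x i : inL x -> Cmod (x i) <= nrm x.
Proof.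
  intros Hx. destruct (domb N i) eqn:E.
  - replace (Cmod (x i)) with (nrm (sscal (x i) (unitvec i))).
    + apply ideal_Cmod; trivial. intros j. unfold sscal, unitvec. rewrite Cmod_mult.
      destruct (Nat.eqb_spec j i) as [->|]; [rewrite Cmod_1; lra|].
      rewrite Cmod_0, Rmult_0_r. apply Cmod_ge_0.
    + rewrite nrm_scal, nrm_unitvec by auto using inL_unitvec. ring.
  - rewrite (inL_out x i), Cmod_0 by trivial. now apply nrm_nonneg.
Qed.

Fixpoint partial_sum (u : nat -> seqC) (n : nat) : seqC :=
  match n with O => szero | S n' => sadd (partial_sum u n') (u n') end.

Lemma inL_partial_sum u n : (forall i, inL (u i)) -> inL (partial_sum u n).
Proof.
  intros H. induction n; simpl; [apply inL_zero|now apply inL_add].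
Qed.

(** Completeness enters here, both for the boundedness of positive operators and for the Neumann
    series. *)
Lemma geometric_series_converges u c q :
  0 <= q < 1 -> (forall n, inL (u n)) -> (forall n, nrm (u n) <= c * q ^ n) ->
  exists s, inL s /\ forall eps, 0 < eps -> exists n0, forall n, (n0 <= n)%nat ->
    nrm (ssub (partial_sum u n) s) < eps.
Proof.
  intros Hq Hu Hb.
  assert (Hc : 0 <= c).
  { specialize (Hb O). simpl in Hb. pose proof (nrm_nonneg _ (Hu O)). lra. }
  (* The exact value of the geometric sum is kept, since the weaker bound without [1 - q ^ d] would
     not survive the induction. *)
  assert (Hd : forall p d, nrm (ssub (partial_sum u (p + d)) (partial_sum u p))
                 <= c / (1 - q) * q ^ p * (1 - q ^ d)).
  { intros p d. induction d as [|d IH].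
    - rewrite Nat.add_0_r. replace (ssub _ _) with szero by seq_ring. rewrite nrm_zero.
      simpl. lra.
    - rewrite Nat.add_succ_r. simpl.
      replace (ssub _ _) with
        (sadd (ssub (partial_sum u (p + d)) (partial_sum u p)) (u (p + d)%nat)) by seq_ring.
      eapply Rle_trans; [apply nrm_add; auto using inL_sub, inL_partial_sum|].
      eapply Rle_trans; [apply Rplus_le_compat; [apply IH|apply Hb]|].
      rewrite pow_add. right. field. lra. }
  destruct HL as [(_ & _ & _ & _ & _ & _ & _ & _ & Hcomplete & _) _].
  apply Hcomplete; [intros; now apply inL_partial_sum|].
  intros eps He.
  assert (Hlim : is_lim_seq (fun n => c / (1 - q) * q ^ n) 0).
  { replace 0 with (c / (1 - q) * 0) by ring.
    apply (is_lim_seq_scal_l _ (c / (1 - q)) 0). apply is_lim_seq_geom.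
    rewrite Rabs_pos_eq; lra. }
  apply is_lim_seq_spec in Hlim. destruct (Hlim (mkposreal _ He)) as [n0 Hn0]. simpl in Hn0.
  assert (Hlt : forall p q', (n0 <= p)%nat -> (p <= q')%nat ->
                 nrm (ssub (partial_sum u q') (partial_sum u p)) < eps).
  { intros p q' H1 H2. replace q' with (p + (q' - p))%nat by lia.
    eapply Rle_lt_trans; [apply Hd|]. specialize (Hn0 p H1).
    rewrite Rminus_0_r in Hn0. apply Rabs_def2 in Hn0.
    assert (0 <= c / (1 - q) * q ^ p).
    { apply Rmult_le_pos; [|apply pow_le; lra]. apply Rmult_le_pos; trivial.
      left. apply Rinv_0_lt_compat. lra. }
    assert (0 <= q ^ (q' - p)) by (apply pow_le; lra). nra. }
  exists n0. intros p p' Hp Hp'. destruct (Nat.le_ge_cases p p') as [H|H].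
  - rewrite nrm_sub_sym by auto using inL_partial_sum. auto.
  - auto.
Qed.

Definition linear_on (T : seqC -> seqC) : Prop :=
  (forall x, inL x -> inL (T x)) /\
  (forall x y, inL x -> inL y -> T (sadd x y) = sadd (T x) (T y)) /\
  (forall c x, inL x -> T (sscal c x) = sscal c (T x)).

(* [T] is dominated by the positive operator [S]: this is [|T x| <= S |x|]. *)
Definition opdom (T S : seqC -> seqC) : Prop :=
  forall x y, inL y -> ldom x y -> ldom (T x) (S y).

(* If [T] were unbounded, pick [x_n] with [|T x_n| > 4^n |x_n|]; the sum of the normalised
   [2^-n |x_n| / |x_n|] would be a vector whose image has norm at least [2^n] for all [n]. *)
Lemma positive_op_bounded T : linear_on T -> opdom T T ->
  exists M, forall x, inL x -> nrm (T x) <= M * nrm x.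
Proof.
  intros (Hin & Hadd & Hscal) Hpos. apply NNPP. intros Hn.
  assert (Hex : forall n : nat, exists x, inL x /\ 4 ^ n * nrm x < nrm (T x)).
  { intros n. apply NNPP. intros H. apply Hn. exists (4 ^ n). intros x Hx.
    apply Rnot_lt_le. intros H'. apply H. now exists x. }
  apply choice in Hex. destruct Hex as [x Hx].
  assert (Hx0 : forall n, 0 < nrm (x n)).
  { intros n. destruct (Hx n) as [H1 H2]. destruct (nrm_nonneg _ H1) as [|E]; trivial.
    exfalso. assert (Hz := nrm_eq0 _ H1 (eq_sym E)). rewrite <- E, Hz in H2.
    replace szero with (sscal 0 szero) in H2 by seq_ring.
    rewrite Hscal, nrm_scal, Cmod_0 in H2 by auto using inL_zero. lra. }
  set (a := fun n => / (2 ^ n * nrm (x n))).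
  assert (Ha : forall n, 0 < a n).
  { intros n. apply Rinv_0_lt_compat, Rmult_lt_0_compat; auto. apply pow_lt; lra. }
  set (z := fun n => sscal (RtoC (a n)) (sabs (x n))).
  assert (Hz : forall n, inL (z n)).
  { intros n. apply inL_scal, sabs_spec, Hx. }
  destruct (geometric_series_converges z 1 (/2) ltac:(lra) Hz) as [s [Hs Hlim]].
  { intros n. unfold z. rewrite nrm_scal by apply sabs_spec, Hx.
    rewrite Cmod_R, Rabs_pos_eq by (specialize (Ha n); lra).
    destruct (sabs_spec (x n)) as [_ ->]; [apply Hx|]. rewrite pow_inv. right. unfold a.
    field. split; [apply pow_nonzero; lra|]. specialize (Hx0 n). lra. }
  assert (Hzr : forall n, ldom (z n) (z n)).
  { intros n. apply ldom_scal; [specialize (Ha n); lra|]. intros i. unfold sabs.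
    rewrite Cmod_R, Rabs_pos_eq by apply Cmod_ge_0. simpl. lra. }
  assert (Hps0 : forall p i, 0 <= Re (partial_sum z p i)).
  { intros p i. induction p as [|p IH]; [simpl; lra|].
    change (0 <= Re (partial_sum z p i) + Re (z p i)).
    pose proof (ldom_refl_nonneg _ _ (Hzr p) i). lra. }
  assert (Hps : forall n p, (n < p)%nat -> ldom (z n) (partial_sum z p)).
  { intros n p Hp. induction p as [|p IH]; [lia|]. intros i.
    change (Cmod (z n i) <= Re (partial_sum z p i) + Re (z p i)).
    pose proof (ldom_refl_nonneg _ _ (Hzr p) i) as H1.
    destruct (Nat.eq_dec n p) as [->|].
    - specialize (Hps0 p i). specialize (Hzr p i). lra.
    - specialize (IH ltac:(lia) i). lra. }
  (* The partial sums eventually dominate [z n], and coordinatewise convergence carries this over to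
     the limit [s]. *)
  assert (Hzs : forall n, ldom (z n) s).
  { intros n i. apply le_epsilon. intros eps He. destruct (Hlim eps He) as [n0 Hn0].
    set (p := Nat.max n0 (S n)). specialize (Hn0 p ltac:(lia)).
    assert (Hc := coord_le (ssub (partial_sum z p) s) i
                    ltac:(auto using inL_sub, inL_partial_sum)).
    assert (Hr := re_le_Cmod (ssub (partial_sum z p) s i)).
    apply Rle_trans with (1 := Hps n p ltac:(lia) i).
    unfold ssub in *. simpl in Hr. unfold Re in *.
    pose proof (Rle_abs (fst (partial_sum z p i) + - fst (s i))). lra. }
  assert (Hbig : forall n, 2 ^ n < nrm (T s)).
  { intros n. apply Rlt_le_trans with (nrm (T (z n))).
    - apply Rlt_le_trans with (a n * nrm (T (x n))).
      + destruct (Hx n) as [_ H]. specialize (Hx0 n).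
        apply Rle_lt_trans with (a n * (4 ^ n * nrm (x n))).
        * right. unfold a. replace 4 with (2 * 2) by ring. rewrite Rpow_mult_distr.
          field. split; [lra|apply pow_nonzero; lra].
        * now apply Rmult_lt_compat_l.
      + unfold z. rewrite Hscal by apply sabs_spec, Hx. rewrite nrm_scal by
          (apply Hin, sabs_spec, Hx). rewrite Cmod_R, Rabs_pos_eq by (specialize (Ha n); lra).
        apply Rmult_le_compat_l; [specialize (Ha n); lra|].
        apply ideal_ldom; [apply Hin, sabs_spec, Hx|].
        apply Hpos; [apply sabs_spec, Hx|apply ldom_sabs].
    - apply ideal_ldom; [now apply Hin|]. now apply Hpos. }
  destruct (Pow_x_infinity 2 ltac:(rewrite Rabs_pos_eq; lra) (nrm (T s))) as [n Hn2].
  specialize (Hn2 n ltac:(lia)). specialize (Hbig n).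
  rewrite Rabs_pos_eq in Hn2 by (apply pow_le; lra). lra.
Qed.

(** * The measure of noncompactness *)

Notation bop := (is_bop inL nrm).
Notation gam := (hnc inL nrm).

Definition coverable (T : seqC -> seqC) (d : R) : Prop :=
  exists Ms, covers inL nrm T d Ms.

Lemma bop_linear T : bop T -> linear_on T.
Proof.
  intros (H1 & H2 & H3 & _). repeat split; trivial; intros;
    apply functional_extensionality; auto.
Qed.

Lemma linear_bop T M : linear_on T -> (forall x, inL x -> nrm (T x) <= M * nrm x) -> bop T.
Proof.
  intros (H1 & H2 & H3) HM. repeat split; trivial.
  - intros. now rewrite H2.
  - intros. now rewrite H3.
  - now exists M.
Qed.

Lemma bop_in T x : bop T -> inL x -> inL (T x).
Proof. intros H; apply H. Qed.

Lemma bop_add T x y : bop T -> inL x -> inL y -> T (sadd x y) = sadd (T x) (T y).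
Proof. intros H. apply (bop_linear T H). Qed.

Lemma bop_scal T c x : bop T -> inL x -> T (sscal c x) = sscal c (T x).
Proof. intros H. apply (bop_linear T H). Qed.

Lemma bop_sub T x y : bop T -> inL x -> inL y -> T (ssub x y) = ssub (T x) (T y).
Proof.
  intros. rewrite !ssub_scal, bop_add, bop_scal; auto using inL_scal.
Qed.

Lemma bop_zero T : bop T -> T szero = szero.
Proof.
  intros H. replace szero with (sscal 0 szero) at 1 by seq_ring.
  rewrite bop_scal by auto using inL_zero. seq_ring.
Qed.

Lemma bop_bound T : bop T -> exists M, 0 < M /\ forall x, inL x -> nrm (T x) <= M * nrm x.
Proof.
  intros (_ & _ & _ & M & HM). exists (Rmax M 1). split.
  - pose proof (Rmax_r M 1). lra.
  - intros x Hx. eapply Rle_trans; [now apply HM|].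
    apply Rmult_le_compat_r; [now apply nrm_nonneg|apply Rmax_l].
Qed.

Lemma bop_comp T S : bop T -> bop S -> bop (fun x => T (S x)).
Proof.
  intros HT HS. destruct (bop_bound T HT) as [M [HM HM']].
  destruct (bop_bound S HS) as [M' [_ HM'']].
  apply (linear_bop _ (M * M')).
  - split; [|split]; intros; auto using bop_in.
    + rewrite !bop_add; auto using bop_in.
    + rewrite !bop_scal; auto using bop_in.
  - intros x Hx. eapply Rle_trans; [auto using bop_in|]. rewrite Rmult_assoc.
    apply Rmult_le_compat_l; [lra|auto].
Qed.

Lemma bop_plus T S : bop T -> bop S -> bop (fun x => sadd (T x) (S x)).
Proof.
  intros HT HS. destruct (bop_bound T HT) as [M [HM HM']].
  destruct (bop_bound S HS) as [M' [_ HM'']].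
  apply (linear_bop _ (M + M')).
  - split; [|split]; intros; auto using bop_in, inL_add.
    + rewrite !bop_add by trivial. seq_ring.
    + rewrite !bop_scal by trivial. seq_ring.
  - intros x Hx. eapply Rle_trans; [auto using bop_in, nrm_add|].
    rewrite Rmult_plus_distr_r. apply Rplus_le_compat; auto.
Qed.

Lemma bop_scale c T : bop T -> bop (fun x => sscal c (T x)).
Proof.
  intros HT. destruct (bop_bound T HT) as [M [HM HM']].
  apply (linear_bop _ (Cmod c * M)).
  - split; [|split]; intros; auto using bop_in, inL_scal.
    + rewrite !bop_add by trivial. seq_ring.
    + rewrite !bop_scal by trivial. seq_ring.
  - intros x Hx. rewrite nrm_scal, Rmult_assoc by auto using bop_in.
    apply Rmult_le_compat_l; [apply Cmod_ge_0|auto].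
Qed.

Lemma bop_minus T S : bop T -> bop S -> bop (fun x => ssub (T x) (S x)).
Proof.
  intros HT HS.
  replace (fun x => ssub (T x) (S x)) with (fun x => sadd (T x) (sscal (Copp 1) (S x))).
  - now apply bop_plus, bop_scale.
  - apply functional_extensionality. intros. now rewrite ssub_scal.
Qed.

Lemma bop_id : bop (fun x => x).
Proof.
  apply (linear_bop _ 1); [now repeat split|]. intros; lra.
Qed.

Lemma bop_null : bop (fun _ => szero).
Proof.
  apply (linear_bop _ 0).
  - split; [|split]; intros; [apply inL_zero|seq_ring|seq_ring].
  - intros. rewrite nrm_zero. lra.
Qed.

Lemma bop_iter T n : bop T -> bop (Nat.iter n T).
Proof.
  intros HT. induction n as [|n IH]; [apply bop_id|]. exact (bop_comp T (Nat.iter n T) HT IH).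
Qed.

Lemma linear_tail T n : linear_on T -> linear_on (fun x => tail n (T x)).
Proof.
  intros (H1 & H2 & H3). split; [|split]; intros.
  - now apply tail_spec, H1.
  - now rewrite H2, tail_add.
  - now rewrite H3, tail_scal.
Qed.

Lemma bop_tail T n : bop T -> bop (fun x => tail n (T x)).
Proof.
  intros HT. destruct (bop_bound T HT) as [M [HM HM']]. apply (linear_bop _ M).
  - now apply linear_tail, bop_linear.
  - intros. eapply Rle_trans; [apply tail_spec; now apply bop_in|auto].
Qed.

Lemma bop_trunc T n : bop T -> bop (fun x => trunc n (T x)).
Proof.
  intros HT. replace (fun x => trunc n (T x)) with (fun x => ssub (T x) (tail n (T x))).
  - now apply bop_minus; [|apply bop_tail].
  - apply functional_extensionality. intros x. rewrite (trunc_add_tail n (T x)) at 1. seq_ring.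
Qed.

Lemma norm_bound_of_ball T d : linear_on T ->
  (forall x, inL x -> nrm x <= 1 -> nrm (T x) <= d) ->
  forall x, inL x -> nrm (T x) <= d * nrm x.
Proof.
  intros (H1 & _ & H3) Hd x Hx. destruct (nrm_nonneg x Hx) as [Hp|E].
  - specialize (Hd (sscal (RtoC (/ nrm x)) x) (inL_scal _ _ Hx)).
    assert (Hi : 0 < / nrm x) by now apply Rinv_0_lt_compat.
    rewrite H3, !nrm_scal, Cmod_R, Rabs_pos_eq in Hd by (auto; lra).
    rewrite Rinv_l in Hd by lra. specialize (Hd (Rle_refl 1)).
    apply (Rmult_le_reg_l (/ nrm x)); [trivial|].
    replace (/ nrm x * (d * nrm x)) with d by (field; lra). trivial.
  - rewrite <- E. apply eq_sym, nrm_eq0 in E; trivial. rewrite E.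
    replace szero with (sscal 0 szero) by seq_ring.
    rewrite H3, nrm_scal, Cmod_0 by auto using inL_zero. lra.
Qed.

Lemma coverable_mono T d d' : d <= d' -> coverable T d -> coverable T d'.
Proof.
  intros Hd [Ms [H1 H2]]. exists Ms. split; trivial. intros x Hx Hx1.
  destruct (H2 x Hx Hx1) as [y [Hy Hy']]. exists y. split; [trivial|lra].
Qed.

Lemma coverable_ext T S d : (forall x, inL x -> T x = S x) -> coverable T d -> coverable S d.
Proof.
  intros E [Ms [H1 H2]]. exists Ms. split; trivial. intros x Hx Hx1. rewrite <- E by trivial.
  auto.
Qed.

Lemma coverable_bound T M : linear_on T -> 0 <= M ->
  (forall x, inL x -> nrm (T x) <= M * nrm x) -> coverable T M.
Proof.
  intros (H1 & _) HM H. exists (szero :: nil). split.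
  - intros y [<-|[]]. apply inL_zero.
  - intros x Hx Hx1. exists szero. split; [now left|].
    replace (ssub (T x) szero) with (T x) by seq_ring.
    eapply Rle_trans; [now apply H|]. pose proof (nrm_nonneg x Hx). nra.
Qed.

Lemma coverable_add T S a b : linear_on T -> linear_on S ->
  coverable T a -> coverable S b -> coverable (fun x => sadd (T x) (S x)) (a + b).
Proof.
  intros [HT _] [HS _] [Ms [H1 H2]] [Ms' [H1' H2']].
  exists (map (fun p => sadd (fst p) (snd p)) (list_prod Ms Ms')). split.
  - intros y Hy. apply in_map_iff in Hy. destruct Hy as [[u v] [<- Huv]].
    apply in_prod_iff in Huv. apply inL_add; [apply H1|apply H1']; apply Huv.
  - intros x Hx Hx1. destruct (H2 x Hx Hx1) as [u [Hu Hu']].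
    destruct (H2' x Hx Hx1) as [v [Hv Hv']]. exists (sadd u v). split.
    + apply in_map_iff. exists (u, v). split; trivial. now apply in_prod.
    + replace (ssub (sadd (T x) (S x)) (sadd u v))
        with (sadd (ssub (T x) u) (ssub (S x) v)) by seq_ring.
      eapply Rle_trans; [apply nrm_add; auto using inL_sub|]. lra.
Qed.

Lemma coverable_scal c T d : linear_on T -> coverable T d ->
  coverable (fun x => sscal c (T x)) (Cmod c * d).
Proof.
  intros [HT _] [Ms [H1 H2]]. exists (map (sscal c) Ms). split.
  - intros y Hy. apply in_map_iff in Hy. destruct Hy as [u [<- Hu]]. auto using inL_scal.
  - intros x Hx Hx1. destruct (H2 x Hx Hx1) as [u [Hu Hu']].
    exists (sscal c u). split; [now apply in_map|].
    replace (ssub (sscal c (T x)) (sscal c u)) with (sscal c (ssub (T x) u)) by seq_ring.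
    rewrite nrm_scal by auto using inL_sub. apply Rmult_le_compat_l; [apply Cmod_ge_0|trivial].
Qed.

(** For [x] in the unit ball write [T x = v + b w] with [v] in the net of [T] and [w] in the unit
    ball. Then [S (T x) = S v + b S w], and [S w] lies within [a] of a point [u] of the net of [S];
    this is why the new net consists of the points [b u + S v]. *)
Lemma coverable_comp S T a b : bop S -> linear_on T -> 0 < b ->
  coverable S a -> coverable T b -> coverable (fun x => S (T x)) (a * b).
Proof.
  intros HS [HT _] Hb [Ms [H1 H2]] [Ms' [H1' H2']].
  exists (map (fun p => sadd (sscal (RtoC b) (fst p)) (S (snd p))) (list_prod Ms Ms')). split.
  - intros y Hy. apply in_map_iff in Hy. destruct Hy as [[u v] [<- Huv]].
    apply in_prod_iff in Huv. destruct Huv. apply inL_add; [apply inL_scal|apply bop_in]; auto.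
  - intros x Hx Hx1. destruct (H2' x Hx Hx1) as [v [Hv Hv']].
    assert (Hi : 0 < / b) by now apply Rinv_0_lt_compat.
    assert (Hd : inL (ssub (T x) v)) by auto using inL_sub.
    destruct (H2 (sscal (RtoC (/ b)) (ssub (T x) v))) as [u [Hu Hu']].
    + now apply inL_scal.
    + rewrite nrm_scal, Cmod_R, Rabs_pos_eq by (trivial; lra).
      apply (Rmult_le_reg_l b); trivial. rewrite <- Rmult_assoc, Rinv_r; lra.
    + exists (sadd (sscal (RtoC b) u) (S v)). split.
      * apply in_map_iff. exists (u, v). split; trivial. now apply in_prod.
      * rewrite bop_scal, bop_sub in Hu' by auto.
        replace (ssub (S (T x)) (sadd (sscal b u) (S v)))
          with (sscal (RtoC b) (ssub (sscal (RtoC (/ b)) (ssub (S (T x)) (S v))) u)).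
        -- rewrite nrm_scal, Cmod_R, Rabs_pos_eq, Rmult_comm
             by (auto 8 using inL_sub, inL_scal, bop_in; lra).
           apply Rmult_le_compat_r; [lra|trivial].
        -- seq_ring. rewrite RtoC_inv by lra. field. intros E. apply RtoC_inj in E. lra.
Qed.

Lemma interval_net B d : 0 < d -> exists l : list R,
  forall t, Rabs t <= B -> exists s, In s l /\ Rabs (t - s) <= d.
Proof.
  (* [K] counts the steps of length [d] in the interval from [- B] to [B]. The absolute value avoids
     a sign condition on [B]; for negative [B] no [t] qualifies. *)
  intros Hd. destruct (nfloor_ex (Rabs (2 * B / d)) (Rabs_pos _)) as [K [_ HK]].
  exists (map (fun k => - B + INR k * d) (seq 0 (S K))). intros t Ht.
  assert (HB := Rle_trans _ _ _ (Rabs_pos t) Ht).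
  assert (Ht' := Ht). apply Rabs_le_between in Ht'.
  assert (Hq : 0 <= (t + B) / d).
  { apply Rmult_le_pos; [lra|]. left; now apply Rinv_0_lt_compat. }
  destruct (nfloor_ex _ Hq) as [k [Hk1 Hk2]].
  assert (E : (t + B) / d * d = t + B) by (field; lra).
  exists (- B + INR k * d). split.
  - apply in_map_iff. exists k. split; trivial. apply in_seq. split; [lia|].
    apply INR_lt. rewrite Nat.add_0_l, S_INR.
    apply Rle_lt_trans with (1 := Hk1). apply Rle_lt_trans with (2 := HK).
    rewrite Rabs_pos_eq.
    + apply (Rmult_le_reg_r d); trivial. rewrite E. replace (2 * B / d * d) with (2 * B)
        by (field; lra). lra.
    + apply Rmult_le_pos; [lra|]. left; now apply Rinv_0_lt_compat.
  - apply Rabs_le. nra.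
Qed.

Lemma disc_net B d : 0 < d -> exists l : list C,
  forall z, Cmod z <= B -> exists w, In w l /\ Cmod (Cminus z w) <= d.
Proof.
  intros Hd. destruct (interval_net B (d / 2) ltac:(lra)) as [l Hl].
  exists (list_prod l l). intros z Hz.
  destruct (Hl (fst z)) as [a [Ha Ha']]; [pose proof (re_le_Cmod z); unfold Re in *; lra|].
  destruct (Hl (snd z)) as [b [Hb Hb']]; [pose proof (Rabs_snd_le_Cmod z); lra|].
  exists (a, b). split; [now apply in_prod|].
  eapply Rle_trans; [apply Cmod_le_fst_snd|].
  change (Rabs (fst z - a) + Rabs (snd z - b) <= d). lra.
Qed.

(** The image of the ball is a bounded set of multiples of one vector, so a net of a disc in the
    plane is enough. Adding finitely many such operators gives the truncations. *)
Lemma coverable_coord T n d : bop T -> 0 < d ->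
  coverable (fun x => sscal (T x n) (unitvec n)) d.
Proof.
  intros HT Hd. destruct (bop_bound T HT) as [M [HM HM']].
  destruct (domb N n) eqn:E.
  - destruct (disc_net M d Hd) as [l Hl].
    exists (map (fun w => sscal w (unitvec n)) l). split.
    + intros y Hy. apply in_map_iff in Hy. destruct Hy as [w [<- _]].
      now apply inL_scal, inL_unitvec.
    + intros x Hx Hx1. destruct (Hl (T x n)) as [w [Hw Hw']].
      * eapply Rle_trans; [now apply coord_le, bop_in|]. specialize (HM' x Hx).
        pose proof (nrm_nonneg x Hx). nra.
      * exists (sscal w (unitvec n)). split; [now apply (in_map (fun w => sscal w _))|].
        replace (ssub _ _) with (sscal (Cminus (T x n) w) (unitvec n)) by seq_ring.
        rewrite nrm_scal, nrm_unitvec, Rmult_1_r by auto using inL_unitvec. trivial.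
  - apply coverable_ext with (fun _ => szero).
    + intros x Hx. rewrite (inL_out (T x) n) by auto using bop_in. seq_ring.
    + apply coverable_mono with 0; [lra|].
      apply coverable_bound; [apply bop_linear, bop_null|lra|].
      intros. rewrite nrm_zero. lra.
Qed.

Lemma linear_coord T n : bop T -> linear_on (fun x => sscal (T x n) (unitvec n)).
Proof.
  intros HT. split; [|split]; intros.
  - now apply inL_coord_unitvec, bop_in.
  - rewrite bop_add by trivial. seq_ring.
  - rewrite bop_scal by trivial. seq_ring.
Qed.

Lemma coverable_trunc T n d : bop T -> 0 < d -> coverable (fun x => trunc n (T x)) d.
Proof.
  intros HT. revert d. induction n as [|n IH]; intros d Hd.
  - apply coverable_mono with 0; [lra|].
    apply coverable_bound; [apply bop_linear, bop_null|lra|].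
    intros. rewrite trunc_0, nrm_zero. lra.
  - apply coverable_ext with (fun x => sadd (trunc n (T x)) (sscal (T x n) (unitvec n))).
    + intros. now rewrite trunc_S.
    + replace d with (d / 2 + d / 2) by field. apply coverable_add.
      * now apply bop_linear, bop_trunc.
      * now apply linear_coord.
      * apply IH; lra.
      * apply coverable_coord; trivial; lra.
Qed.

(** [real] sends infinite values to 0, so a value of [real (Glb_Rbar E)] is a true infimum only once
    finiteness is known; nonemptiness and the lower bound 0 provide it. *)
Lemma Glb_nonneg (E : R -> Prop) : (exists x, E x) -> (forall x, E x -> 0 <= x) ->
  0 <= real (Glb_Rbar E) /\ (forall x, E x -> real (Glb_Rbar E) <= x) /\
  (forall d, real (Glb_Rbar E) < d -> exists x, E x /\ x < d).
Proof.
  intros [x0 Hx0] H0. destruct (Glb_Rbar_correct E) as [Hlb Hg].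
  assert (H1 : Rbar_le 0 (Glb_Rbar E)) by (apply Hg; intros x Hx; simpl; auto).
  pose proof (Hlb x0 Hx0) as H2.
  destruct (Glb_Rbar E) as [g| |]; simpl in *; try contradiction.
  split; [trivial|split; [exact Hlb|]].
  intros d Hd. apply NNPP. intros Hn.
  assert (Rbar_le d g); [|simpl in *; lra].
  apply Hg. intros x Hx. simpl. apply Rnot_lt_le. intros Hlt. apply Hn. now exists x.
Qed.

Lemma hnc_nonneg T : 0 <= gam T.
Proof.
  unfold hnc.
  destruct (classic (exists d, 0 < d /\ exists Ms, covers inL nrm T d Ms)) as [He|He].
  - apply (Glb_nonneg _ He). intros x [H _]. lra.
  (* Without any admissible radius the infimum is [p_infty], whose real value is 0 by convention. *)
  - rewrite (Glb_Rbar_eqset _ (fun _ => False)).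
    + destruct (Glb_Rbar_correct (fun _ : R => False)) as [_ Hg].
      specialize (Hg p_infty). destruct (Glb_Rbar _); simpl in *; try lra.
      exfalso. apply Hg. now intros x.
    + intros x. split; [|easy]. intros H. apply He. now exists x.
Qed.

Lemma hnc_ext T S : (forall x, inL x -> T x = S x) -> gam T = gam S.
Proof.
  intros E. unfold hnc. f_equal. apply Glb_Rbar_eqset. intros d.
  split; intros [Hd H]; (split; [trivial|]); revert H; apply coverable_ext; trivial.
  intros; now rewrite E.
Qed.

Lemma hnc_nonempty T : bop T -> exists d, 0 < d /\ exists Ms, covers inL nrm T d Ms.
Proof.
  intros HT. destruct (bop_bound T HT) as [M [HM HM']]. exists M. split; trivial.
  apply coverable_bound; trivial; [now apply bop_linear|lra].
Qed.

Lemma coverable_hnc T d : bop T -> gam T < d -> coverable T d.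
Proof.
  intros HT Hd. destruct (Glb_nonneg _ (hnc_nonempty T HT)) as (_ & _ & H).
  { intros x [H _]. lra. }
  destruct (H d Hd) as [x [[_ Hx] Hxd]]. apply coverable_mono with x; [lra|trivial].
Qed.

Lemma hnc_le T d : 0 < d -> coverable T d -> gam T <= d.
Proof.
  intros Hd H.
  destruct (Glb_nonneg (fun d => 0 < d /\ exists Ms, covers inL nrm T d Ms)) as (_ & Hl & _).
  - now exists d.
  - intros x [H' _]. lra.
  - now apply Hl.
Qed.

Lemma hnc_le_eps T d : 0 <= d -> (forall eps, 0 < eps -> coverable T (d + eps)) -> gam T <= d.
Proof.
  intros Hd H. apply le_epsilon. intros eps He. apply hnc_le; [lra|auto].
Qed.

Lemma hnc_add T S : bop T -> bop S -> gam (fun x => sadd (T x) (S x)) <= gam T + gam S.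
Proof.
  intros HT HS. pose proof (hnc_nonneg T). pose proof (hnc_nonneg S).
  apply hnc_le_eps; [lra|]. intros eps He.
  replace (gam T + gam S + eps) with ((gam T + eps / 2) + (gam S + eps / 2)) by field.
  apply coverable_add; auto using bop_linear; apply coverable_hnc; trivial; lra.
Qed.

Lemma hnc_scal c T : bop T -> gam (fun x => sscal c (T x)) <= Cmod c * gam T.
Proof.
  intros HT. pose proof (hnc_nonneg T). pose proof (Cmod_ge_0 c).
  apply hnc_le_eps; [nra|]. intros eps He.
  apply coverable_mono with (Cmod c * (gam T + eps / (Cmod c + 1))).
  - rewrite Rmult_plus_distr_l. apply Rplus_le_compat_l.
    apply (Rmult_le_reg_r (Cmod c + 1)); [lra|].
    replace (Cmod c * (eps / (Cmod c + 1)) * (Cmod c + 1)) with (Cmod c * eps) by (field; lra).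
    nra.
  - apply coverable_scal; [now apply bop_linear|]. apply coverable_hnc; trivial.
    assert (0 < eps / (Cmod c + 1)) by (apply Rdiv_lt_0_compat; lra). lra.
Qed.

Lemma hnc_minus T S : bop T -> bop S -> gam (fun x => ssub (T x) (S x)) <= gam T + gam S.
Proof.
  intros HT HS. rewrite (hnc_ext _ (fun x => sadd (T x) (sscal (Copp 1) (S x))))
    by (intros; apply ssub_scal).
  eapply Rle_trans; [apply hnc_add; auto using bop_scale|].
  pose proof (hnc_scal (Copp 1) S HS) as H. rewrite Cmod_m1 in H. lra.
Qed.

Lemma hnc_comp S T : bop S -> bop T -> gam (fun x => S (T x)) <= gam S * gam T.
Proof.
  intros HS HT. pose proof (hnc_nonneg T). pose proof (hnc_nonneg S).
  apply hnc_le_eps; [nra|]. intros eps He.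
  (* With [e <= 1] the product of [gam S + e] and [gam T + e] exceeds [gam S * gam T] by at most
     [e * (gam S + gam T + 1)]. *)
  set (e := Rmin 1 (eps / (gam S + gam T + 1))).
  assert (He' : 0 < eps / (gam S + gam T + 1)) by (apply Rdiv_lt_0_compat; lra).
  assert (0 < e) by (apply Rmin_glb_lt; lra).
  assert (e <= 1) by apply Rmin_l.
  assert (e * (gam S + gam T + 1) <= eps).
  { replace eps with (eps / (gam S + gam T + 1) * (gam S + gam T + 1)) by (field; lra).
    apply Rmult_le_compat_r; [lra|apply Rmin_r]. }
  apply coverable_mono with ((gam S + e) * (gam T + e)); [nra|].
  apply coverable_comp; auto using bop_linear; try lra; apply coverable_hnc; trivial; lra.
Qed.

(** Compactness is stated as total boundedness, which is the vanishing of the measure of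
    noncompactness. The ideal properties of compact operators then follow from subadditivity and
    submultiplicativity. *)
Lemma hnc_compact K : is_compact_op inL nrm K -> gam K = 0.
Proof.
  intros [HK H]. apply Rle_antisym; [|apply hnc_nonneg].
  apply hnc_le_eps; [lra|]. intros eps He. apply H. lra.
Qed.

Lemma compact_of_hnc K : bop K -> gam K = 0 -> is_compact_op inL nrm K.
Proof.
  intros HK H. split; trivial. intros d Hd. apply coverable_hnc; trivial. lra.
Qed.

Lemma hnc_trunc T n : bop T -> gam (fun x => trunc n (T x)) = 0.
Proof.
  intros HT. apply Rle_antisym; [|apply hnc_nonneg].
  apply hnc_le_eps; [lra|]. intros. apply coverable_trunc; trivial. lra.
Qed.

Lemma hnc_le_norm T d : bop T -> 0 <= d ->
  (forall x, inL x -> nrm (T x) <= d * nrm x) -> gam T <= d.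
Proof.
  intros HT Hd H. apply hnc_le_eps; trivial. intros. apply coverable_mono with d; [lra|].
  apply coverable_bound; trivial. now apply bop_linear.
Qed.

Lemma hnc_le_tail T n d : bop T -> 0 <= d ->
  (forall x, inL x -> nrm (tail n (T x)) <= d * nrm x) -> gam T <= d.
Proof.
  intros HT Hd H.
  rewrite (hnc_ext T (fun x => sadd (trunc n (T x)) (tail n (T x))))
    by (intros; apply trunc_add_tail).
  eapply Rle_trans; [apply hnc_add; auto using bop_tail, bop_trunc|].
  rewrite hnc_trunc, Rplus_0_l by trivial. apply hnc_le_norm; auto using bop_tail.
Qed.

(** * Consequences of the order continuity of the norm *)

Context (Hoc : order_continuous_L inL nrm).

(** Order continuity is applied to the sequence of tails of [sabs x], which decreases to 0. *)
Lemma tail_vanishes x eps : inL x -> 0 < eps ->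
  exists n0, forall n, (n0 <= n)%nat -> nrm (tail n x) < eps.
Proof.
  intros Hx He. destruct (sabs_spec x Hx) as [Hax _].
  destruct (Hoc nat le (fun n => tail n (sabs x))) with (eps := eps) as [n0 Hn0]; trivial.
  - split; [exact (inhabits O)|]. split; [auto|]. split; [intros; lia|].
    intros a b. exists (Nat.max a b). lia.
  - intros n. split; [now apply tail_spec|]. intros i. unfold tail, sabs.
    destruct (Nat.ltb i n); simpl; [lra|]. split; [easy|apply Cmod_ge_0].
  - intros a b Hab i. unfold tail, sabs.
    destruct (Nat.ltb_spec i a), (Nat.ltb_spec i b); simpl; try lia; try lra.
    apply Cmod_ge_0.
  (* A lower bound of all tails is at most 0 at [i], since the tail from [S i] on vanishes there. *)
  - intros g _ _ Hg i. specialize (Hg (S i) i). unfold tail in Hg.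
    destruct (Nat.ltb_spec i (S i)); [exact Hg|lia].
  - exists n0. intros n Hn. eapply Rle_lt_trans; [|exact (Hn0 n Hn)].
    apply ideal_ldom; [now apply tail_spec|]. apply ldom_tail, ldom_sabs.
Qed.

Lemma tail_vanishes_list Ms eps : (forall y, In y Ms -> inL y) -> 0 < eps ->
  exists n0, forall y, In y Ms -> nrm (tail n0 y) < eps.
Proof.
  intros H He. induction Ms as [|y Ms IH]; [exists O; now intros y []|].
  destruct IH as [n1 H1]; [intros; apply H; now right|].
  destruct (tail_vanishes y eps) as [n2 H2]; [apply H; now left|trivial|].
  exists (Nat.max n1 n2). intros z [<-|Hz].
  - apply H2. lia.
  - eapply Rle_lt_trans; [apply (tail_le n1)|auto]; [apply H; now right|lia].
Qed.

(* [hnc T] is the limit of the norms of [tail n o T]: a finite net is moved by [tail n]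
   close to zero, and conversely [trunc n o T] has finite rank. *)
Lemma tail_norm_of_hnc T d : bop T -> gam T < d ->
  exists n, forall p, (n <= p)%nat -> forall x, inL x -> nrm (tail p (T x)) <= d * nrm x.
Proof.
  (* Half of the gap pays for the radius of the net, which is still above [gam T], and the other
     half for the tails of the net points. *)
  intros HT Hd. set (e := (d - gam T) / 2).
  destruct (coverable_hnc T (d - e) HT) as [Ms [H1 H2]]; [unfold e; lra|].
  destruct (tail_vanishes_list Ms e H1) as [n Hn]; [unfold e; lra|].
  exists n. intros p Hp. apply norm_bound_of_ball; [now apply linear_tail, bop_linear|].
  intros x Hx Hx1. destruct (H2 x Hx Hx1) as [y [Hy Hy']].
  assert (HTx : inL (T x)) by now apply bop_in.
  replace (tail p (T x)) with (sadd (tail p (ssub (T x) y)) (tail p y)).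
  - eapply Rle_trans; [apply nrm_add; apply tail_spec; auto using inL_sub|].
    assert (nrm (tail p (ssub (T x) y)) <= nrm (ssub (T x) y))
      by (apply tail_spec; auto using inL_sub).
    assert (nrm (tail p y) <= nrm (tail n y)) by (apply tail_le; auto).
    specialize (Hn y Hy). lra.
  - rewrite tail_sub. seq_ring.
Qed.

(** Compare [T x] with [S] applied to [sabs x], which has the same norm as [x]. *)
Lemma opdom_norm T S c : bop S -> opdom T S ->
  (forall x, inL x -> nrm (S x) <= c * nrm x) -> forall x, inL x -> nrm (T x) <= c * nrm x.
Proof.
  intros HS Hdom H x Hx. destruct (sabs_spec x Hx) as [H1 H2]. rewrite <- H2.
  eapply Rle_trans; [|now apply H]. apply ideal_ldom; [now apply bop_in|].
  apply Hdom; trivial. apply ldom_sabs.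
Qed.

Lemma opdom_tail T S n : opdom T S -> opdom (fun x => tail n (T x)) (fun x => tail n (S x)).
Proof. intros H x y Hy Hxy. now apply ldom_tail, H. Qed.

Lemma hnc_mono T S : bop T -> bop S -> opdom T S -> gam T <= gam S.
Proof.
  intros HT HS Hdom. apply le_epsilon. intros eps He.
  destruct (tail_norm_of_hnc S (gam S + eps) HS) as [n Hn]; [lra|].
  apply (hnc_le_tail T n); trivial; [pose proof (hnc_nonneg S); lra|].
  apply (opdom_norm _ (fun x => tail n (S x))); auto using bop_tail, opdom_tail.
Qed.

(** * The essential spectral radius of a positive operator *)

Lemma opdom_comp T S T' S' : (forall x, inL x -> inL (S' x)) ->
  opdom T S -> opdom T' S' -> opdom (fun x => T (T' x)) (fun x => S (S' x)).
Proof. intros Hin H H' x y Hy Hxy. apply H; [now apply Hin|now apply H']. Qed.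

Lemma opdom_plus T S T' S' : opdom T S -> opdom T' S' ->
  opdom (fun x => sadd (T x) (T' x)) (fun x => sadd (S x) (S' x)).
Proof. intros H H' x y Hy Hxy. apply ldom_add; auto. Qed.

Lemma opdom_scale a T S : 0 <= a -> opdom T S ->
  opdom (fun x => sscal (RtoC a) (T x)) (fun x => sscal (RtoC a) (S x)).
Proof. intros Ha H x y Hy Hxy. apply ldom_scal; [lra|auto]. Qed.

Lemma opdom_null T : opdom T T -> opdom (fun _ => szero) T.
Proof.
  intros H x y Hy Hxy i. unfold szero. rewrite Cmod_0.
  exact (ldom_refl_nonneg _ _ (H x y Hy Hxy) i).
Qed.

Lemma opdom_ext T T' S : (forall x, T x = T' x) -> opdom T S -> opdom T' S.
Proof. intros E H x y Hy Hxy. rewrite <- E. auto. Qed.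

Lemma opdom_iter T S n : bop S -> opdom T S -> opdom (Nat.iter n T) (Nat.iter n S).
Proof.
  intros HS H. induction n as [|n IH]; [now intros x y|].
  exact (opdom_comp T S _ _ (fun x Hx => bop_in _ x (bop_iter S n HS) Hx) H IH).
Qed.

Lemma compact_plus T S : is_compact_op inL nrm T -> is_compact_op inL nrm S ->
  is_compact_op inL nrm (fun x => sadd (T x) (S x)).
Proof.
  intros HT HS. pose proof (hnc_add T S (proj1 HT) (proj1 HS)) as H.
  rewrite (hnc_compact T), (hnc_compact S) in H by trivial.
  apply compact_of_hnc; [apply bop_plus; [apply HT|apply HS]|].
  apply Rle_antisym; [lra|apply hnc_nonneg].
Qed.

Lemma compact_comp_l S T : bop S -> is_compact_op inL nrm T ->
  is_compact_op inL nrm (fun x => S (T x)).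
Proof.
  intros HS HT. pose proof (hnc_comp S T HS (proj1 HT)) as H.
  rewrite (hnc_compact T), Rmult_0_r in H by trivial.
  apply compact_of_hnc; [apply bop_comp; [trivial|apply HT]|].
  apply Rle_antisym; [lra|apply hnc_nonneg].
Qed.

Lemma compact_comp_r S T : bop T -> is_compact_op inL nrm S ->
  is_compact_op inL nrm (fun x => S (T x)).
Proof.
  intros HT HS. pose proof (hnc_comp S T (proj1 HS) HT) as H.
  rewrite (hnc_compact S), Rmult_0_l in H by trivial.
  apply compact_of_hnc; [apply bop_comp; [apply HS|trivial]|].
  apply Rle_antisym; [lra|apply hnc_nonneg].
Qed.

Lemma bop_ext T S : (forall x, inL x -> T x = S x) -> bop T -> bop S.
Proof.
  intros E HT. destruct (bop_bound T HT) as [M [_ HM]]. apply (linear_bop _ M).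
  - split; [|split]; intros; rewrite <- !E by auto using inL_add, inL_scal;
      auto using bop_in, bop_add, bop_scal.
  - intros. rewrite <- E; auto.
Qed.

Lemma compact_ext T S : (forall x, inL x -> T x = S x) ->
  is_compact_op inL nrm T -> is_compact_op inL nrm S.
Proof.
  intros E [HT H]. split; [now apply (bop_ext T)|]. intros d Hd.
  now apply (coverable_ext T), H.
Qed.

Lemma compact_trunc T n : bop T -> is_compact_op inL nrm (fun x => trunc n (T x)).
Proof. intros HT. split; [now apply bop_trunc|]. intros. now apply coverable_trunc. Qed.

(** * Neumann series and inverses modulo compact operators *)

Lemma bop_scalar c : bop (fun x => sscal c x).
Proof. apply (bop_scale c (fun x => x)), bop_id. Qed.

(** The map [1 - U] is bounded below by [1 - q], hence injective, and the series of iterates solves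
    [x - U x = y]. The inverse is then taken by choice: its linearity and the left inverse property
    follow from injectivity, its boundedness from the lower bound. *)
Lemma neumann_inverse U q : bop U -> 0 <= q < 1 ->
  (forall x, inL x -> nrm (U x) <= q * nrm x) ->
  exists S, bop S /\ (forall x, inL x -> S (ssub x (U x)) = x) /\
    (forall x, inL x -> ssub (S x) (U (S x)) = x).
Proof.
  intros HU Hq HqU.
  assert (Hlow : forall x, inL x -> (1 - q) * nrm x <= nrm (ssub x (U x))).
  { intros x Hx. assert (HUx : inL (U x)) by now apply bop_in.
    replace x with (sadd (ssub x (U x)) (U x)) at 1 by seq_ring.
    pose proof (nrm_add (ssub x (U x)) (U x) ltac:(now apply inL_sub) HUx).
    replace (sadd (ssub x (U x)) (U x)) with x in * by seq_ring.
    specialize (HqU x Hx). lra. }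
  assert (Hinj : forall x y, inL x -> inL y -> ssub x (U x) = ssub y (U y) -> x = y).
  { intros x y Hx Hy E. assert (Hxy : inL (ssub x y)) by now apply inL_sub.
    assert (E0 : ssub (ssub x y) (U (ssub x y)) = szero).
    { rewrite bop_sub by trivial.
      replace (ssub (ssub x y) (ssub (U x) (U y)))
        with (ssub (ssub x (U x)) (ssub y (U y))) by seq_ring.
      rewrite E. seq_ring. }
    specialize (Hlow _ Hxy). rewrite E0, nrm_zero in Hlow.
    assert (Hz : ssub x y = szero).
    { apply nrm_eq0; trivial. pose proof (nrm_nonneg _ Hxy). nra. }
    replace x with (sadd (ssub x y) y) by seq_ring. rewrite Hz. seq_ring. }
  (* The premise [inL y] stands under the existential quantifier so that choice yields a function on
     all sequences. *)
  assert (Hsurj : forall y, exists x, inL y -> inL x /\ ssub x (U x) = y).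
  { intros y. destruct (classic (inL y)) as [Hy|]; [|now exists y].
    set (u := fun n => Nat.iter n U y).
    assert (Hu : forall n, inL (u n)) by (intros n; apply bop_in; [now apply bop_iter|trivial]).
    destruct (geometric_series_converges u (nrm y) q Hq Hu) as [s [Hs Hlim]].
    { intros n. induction n as [|n IH]; [simpl; lra|].
      change (nrm (U (u n)) <= nrm y * (q * q ^ n)).
      specialize (HqU _ (Hu n)). eapply Rle_trans; [exact HqU|].
      replace (nrm y * (q * q ^ n)) with (q * (nrm y * q ^ n)) by ring.
      apply Rmult_le_compat_l; [lra|trivial]. }
    exists s. intros _. split; trivial.
    (* In the limit this recursion becomes [s = y + U s]. *)
    assert (Hps : forall n, partial_sum u (S n) = sadd y (U (partial_sum u n))).
    { intros n. induction n as [|n IH].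
      - simpl. rewrite bop_zero by trivial. unfold u. simpl. seq_ring.
      - change (partial_sum u (S (S n))) with (sadd (partial_sum u (S n)) (U (u n))).
        rewrite IH at 1. change (partial_sum u (S n)) with (sadd (partial_sum u n) (u n)).
        rewrite bop_add by auto using inL_partial_sum. seq_ring. }
    assert (HUs : inL (U s)) by now apply bop_in.
    assert (Hz : ssub (ssub s (U s)) y = szero).
    { apply nrm_eq0; [auto using inL_sub|]. apply Rle_antisym;
        [|apply nrm_nonneg; auto using inL_sub].
      apply le_epsilon. intros eps He. destruct (Hlim (eps / 2)) as [n0 Hn0]; [lra|].
      pose proof (Hn0 n0 ltac:(lia)) as H1. pose proof (Hn0 (S n0) ltac:(lia)) as H2.
      assert (Hp : forall n, inL (partial_sum u n)) by (intros; now apply inL_partial_sum).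
      replace (ssub (ssub s (U s)) y)
        with (ssub (U (ssub (partial_sum u n0) s)) (ssub (partial_sum u (S n0)) s)).
      - eapply Rle_trans; [apply nrm_sub; auto using inL_sub, bop_in|].
        specialize (HqU _ (inL_sub _ _ (Hp n0) Hs)).
        pose proof (nrm_nonneg _ (inL_sub _ _ (Hp n0) Hs)). nra.
      - rewrite Hps, (bop_sub U) by trivial. seq_ring. }
    replace (ssub s (U s)) with (sadd (ssub (ssub s (U s)) y) y) by seq_ring.
    rewrite Hz. seq_ring. }
  apply choice in Hsurj. destruct Hsurj as [S HS]. exists S.
  assert (HSin : forall y, inL y -> inL (S y)) by (intros; now apply HS).
  assert (HSr : forall y, inL y -> ssub (S y) (U (S y)) = y) by (intros; now apply HS).
  repeat split; trivial.
  - intros x y Hx Hy i. apply f_equal with (f := fun f => f i).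
    apply Hinj; auto using inL_add. rewrite HSr by auto using inL_add.
    rewrite bop_add by auto. rewrite <- (HSr x Hx) at 1. rewrite <- (HSr y Hy) at 1. seq_ring.
  - intros c x Hx i. apply f_equal with (f := fun f => f i).
    apply Hinj; auto using inL_scal. rewrite HSr by auto using inL_scal.
    rewrite bop_scal by auto. rewrite <- (HSr x Hx) at 1. seq_ring.
  - exists (/ (1 - q)). intros x Hx. apply (Rmult_le_reg_l (1 - q)); [lra|].
    rewrite <- Rmult_assoc, Rinv_r, Rmult_1_l by lra.
    rewrite <- (HSr x Hx) at 2. auto.
  - intros x Hx. assert (inL (ssub x (U x))) by auto using inL_sub, bop_in.
    apply Hinj; auto.
Qed.

(** The cofactor of [1 - U] in [1 - U^n]. With [U = T / lam] it also serves as an approximate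
    resolvent of [T], up to the factor [lam]. *)
Fixpoint gsum (U : seqC -> seqC) (n : nat) (x : seqC) : seqC :=
  match n with O => szero | S n' => sadd (gsum U n' x) (Nat.iter n' U x) end.

Lemma bop_gsum U n : bop U -> bop (gsum U n).
Proof.
  intros HU. induction n as [|n IH]; [apply bop_null|].
  exact (bop_plus _ _ IH (bop_iter U n HU)).
Qed.

Lemma iter_swap (U : seqC -> seqC) n x : Nat.iter n U (U x) = U (Nat.iter n U x).
Proof. induction n as [|n IH]; simpl; congruence. Qed.

Lemma gsum_left U n x : bop U -> inL x ->
  gsum U n (ssub x (U x)) = ssub x (Nat.iter n U x).
Proof.
  intros HU Hx. induction n as [|n IH]; simpl; [seq_ring|].
  rewrite IH. rewrite bop_sub, iter_swap by auto using bop_iter, bop_in. seq_ring.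
Qed.

Lemma gsum_right U n x : bop U -> inL x ->
  ssub (gsum U n x) (U (gsum U n x)) = ssub x (Nat.iter n U x).
Proof.
  intros HU Hx. induction n as [|n IH]; simpl; [rewrite bop_zero by trivial; seq_ring|].
  rewrite bop_add by auto using bop_iter, bop_in, bop_gsum.
  replace (ssub _ _) with (sadd (ssub (gsum U n x) (U (gsum U n x)))
    (ssub (Nat.iter n U x) (U (Nat.iter n U x)))) by seq_ring.
  rewrite IH. seq_ring.
Qed.

(* Up to the finite rank operator [trunc p o U^n], the operator [1 - U^n] is [1 - V] with
   [|V| < 1], hence invertible; and [1 - U] divides [1 - U^n] on both sides. *)
Lemma calkin_inverse U n : bop U -> gam (Nat.iter n U) < 1 ->
  exists S, bop S /\
    is_compact_op inL nrm (fun x => ssub (S (ssub x (U x))) x) /\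
    is_compact_op inL nrm (fun x => ssub (ssub (S x) (U (S x))) x).
Proof.
  intros HU Hlt. assert (HUn := bop_iter U n HU). set (Un := Nat.iter n U) in *.
  set (d := (1 + gam Un) / 2).
  destruct (tail_norm_of_hnc Un d HUn) as [p Hp]; [unfold d; lra|].
  specialize (Hp p (le_n p)). pose proof (hnc_nonneg Un).
  assert (HV := bop_tail Un p HUn).
  destruct (neumann_inverse (fun x => tail p (Un x)) d HV) as (S0 & HS0 & Hleft & Hright);
    [unfold d; lra|trivial|].
  pose proof (bop_gsum U n HU) as HW. set (W := gsum U n) in *.
  assert (HT := bop_trunc Un p HUn).
  (* Finite rank errors: [S0 W] is a left inverse of [1 - U] up to [F], and [W S0] is a right
     inverse up to [G]. *)
  set (F := fun x => S0 (trunc p (Un x))). set (G := fun x => trunc p (Un (S0 x))).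
  assert (HF : is_compact_op inL nrm F)
    by (apply (compact_comp_l S0 (fun x => trunc p (Un x))); [|apply compact_trunc]; trivial).
  assert (HG : is_compact_op inL nrm G)
    by (apply (compact_comp_r (fun x => trunc p (Un x)) S0); [|apply compact_trunc]; trivial).
  assert (EL : forall x, inL x -> S0 (W (ssub x (U x))) = ssub x (F x)).
  { intros x Hx. unfold W. rewrite gsum_left by trivial. fold Un.
    rewrite (trunc_add_tail p (Un x)).
    replace (ssub x _) with (ssub (ssub x (tail p (Un x))) (trunc p (Un x))) by seq_ring.
    rewrite (bop_sub S0), Hleft; trivial;
      [apply inL_sub; [trivial|exact (bop_in _ x HV Hx)]|exact (bop_in _ x HT Hx)]. }
  assert (ER : forall x, inL x -> ssub (W (S0 x)) (U (W (S0 x))) = ssub x (G x)).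
  { intros x Hx. unfold W. rewrite gsum_right by auto using bop_in. fold Un.
    rewrite (trunc_add_tail p (Un (S0 x))).
    replace (ssub (S0 x) _)
      with (ssub (ssub (S0 x) (tail p (Un (S0 x)))) (trunc p (Un (S0 x)))) by seq_ring.
    now rewrite Hright. }
  (* As in any algebra, the left and the right inverse agree modulo the ideal. Computing
     [S0 W (1 - U) W S0] in two ways gives [S0 W - S0 W G = W S0 - F W S0], so [D] is the difference
     of [S0 W] and [W S0]. *)
  set (D := fun x => sadd (sscal (Copp 1) (F (W (S0 x)))) (S0 (W (G x)))).
  assert (HD : is_compact_op inL nrm D).
  { apply (compact_plus (fun x => sscal (Copp 1) (F (W (S0 x))))).
    - apply (compact_comp_l (fun x => sscal (Copp 1) x)); [apply bop_scalar|].
      apply (compact_comp_r F (fun x => W (S0 x))); [now apply bop_comp|trivial].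
    - apply (compact_comp_l (fun x => S0 (W x))); [now apply bop_comp|trivial]. }
  assert (ED : forall x, inL x -> S0 (W x) = sadd (W (S0 x)) (D x)).
  { intros x Hx. assert (HSW : bop (fun x => S0 (W x))) by now apply bop_comp.
    assert (Hr : inL (W (S0 x))) by auto using bop_in.
    assert (HGx : inL (G x)) by (apply bop_in; [apply HG|trivial]).
    pose proof (EL _ Hr) as E. rewrite ER in E by trivial.
    rewrite (bop_sub _ _ _ HSW) in E by trivial. unfold D.
    replace (S0 (W x)) with (sadd (ssub (S0 (W x)) (S0 (W (G x)))) (S0 (W (G x)))) by seq_ring.
    rewrite E. seq_ring. }
  exists (fun x => S0 (W x)). split; [now apply bop_comp|]. split.
  - apply (compact_ext (fun x => sscal (Copp 1) (F x))).
    + intros x Hx. rewrite EL by trivial. seq_ring.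
    + apply (compact_comp_l (fun x => sscal (Copp 1) x)); [apply bop_scalar|trivial].
  - apply (compact_ext (fun x => sadd (sscal (Copp 1) (G x)) (ssub (D x) (U (D x))))).
    + intros x Hx. rewrite ED by trivial.
      assert (HDx : inL (D x)) by (apply bop_in; [apply HD|trivial]).
      rewrite bop_add by auto using bop_in.
      replace (ssub (ssub (sadd (W (S0 x)) (D x)) (sadd (U (W (S0 x))) (U (D x)))) x)
        with (sadd (ssub (ssub (W (S0 x)) (U (W (S0 x)))) x) (ssub (D x) (U (D x))))
        by seq_ring.
      rewrite ER by trivial. seq_ring.
    + apply compact_plus.
      * apply (compact_comp_l (fun x => sscal (Copp 1) x)); [apply bop_scalar|trivial].
      * apply (compact_comp_l (fun x => ssub x (U x))); [|trivial].
        apply (bop_minus (fun x => x) U); [apply bop_id|trivial].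
Qed.

Lemma iter_scale T c n x : bop T -> inL x ->
  Nat.iter n (fun x => sscal c (T x)) x = sscal (Cpow c n) (Nat.iter n T x).
Proof.
  intros HT Hx. induction n as [|n IH]; simpl; [seq_ring|].
  rewrite IH, bop_scal by auto using bop_in, bop_iter. seq_ring.
Qed.

Lemma hnc_scal_eq (c : C) T : bop T -> c <> 0 -> gam (fun x => sscal c (T x)) = Cmod c * gam T.
Proof.
  intros HT Hc. apply Rle_antisym; [now apply hnc_scal|].
  pose proof (hnc_scal (Cinv c) (fun x => sscal c (T x)) (bop_scale c T HT)) as H.
  cbv beta in H. rewrite (hnc_ext (fun x => sscal (Cinv c) (sscal c (T x))) T) in H
    by (intros; seq_ring; field; trivial).
  rewrite Cmod_inv in H by trivial. assert (0 < Cmod c) by now apply Cmod_gt_0.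
  apply (Rmult_le_reg_l (/ Cmod c)); [now apply Rinv_0_lt_compat|].
  rewrite <- Rmult_assoc, Rinv_l by lra. lra.
Qed.

(** Factor [lam - T] as [lam (1 - U)] with [U = T / lam]. The hypothesis says that the n-th power of
    [U] has measure below 1, so [calkin_inverse] applies, and its result is divided by [lam]. *)
Lemma not_in_ess_spectrum T n lam : bop T -> gam (Nat.iter n T) < Cmod lam ^ n ->
  lam <> 0 -> ~ in_ess_spectrum inL nrm T lam.
Proof.
  intros HT Hlt Hlam Hess. apply Hess.
  set (U := fun x => sscal (Cinv lam) (T x)).
  assert (HU : bop U) by now apply bop_scale.
  assert (Hm : 0 < Cmod lam) by now apply Cmod_gt_0.
  destruct (calkin_inverse U n HU) as (S & HS & H1 & H2).
  { rewrite (hnc_ext _ (fun x => sscal (Cpow (Cinv lam) n) (Nat.iter n T x)))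
      by (intros; now apply iter_scale).
    eapply Rle_lt_trans; [apply hnc_scal; now apply bop_iter|].
    rewrite Cmod_pow, Cmod_inv, pow_inv by trivial.
    assert (0 < Cmod lam ^ n) by now apply pow_lt.
    apply (Rmult_lt_reg_l (Cmod lam ^ n)); trivial.
    rewrite <- Rmult_assoc, Rinv_r; lra. }
  exists (fun x => sscal (Cinv lam) (S x)). split; [now apply bop_scale|]. split.
  - revert H1. apply compact_ext. intros x Hx. f_equal.
    assert (inL (T x)) by now apply bop_in.
    rewrite <- (bop_scal S) by auto using inL_sub, inL_scal. f_equal.
    unfold U. seq_ring. field. trivial.
  - revert H2. apply compact_ext. intros x Hx. f_equal. rewrite (bop_scal T) by auto using bop_in.
    unfold U. seq_ring. field. trivial.
Qed.

Lemma Lub_nonneg (E : R -> Prop) b : E 0 -> (forall x, E x -> x <= b) ->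
  real (Lub_Rbar E) <= b /\ (forall x, E x -> x <= real (Lub_Rbar E)).
Proof.
  intros H0 Hb. destruct (Lub_Rbar_correct E) as [Hub Hl].
  assert (H1 : Rbar_le (Lub_Rbar E) b) by (apply Hl; intros x Hx; simpl; auto).
  pose proof (Hub 0 H0) as H2.
  destruct (Lub_Rbar E) as [g| |]; simpl in *; try contradiction.
  split; [trivial|exact Hub].
Qed.

Lemma ess_spectrum_bound T n s lam : bop T -> 0 < s -> gam (Nat.iter n T) < s ^ n ->
  in_ess_spectrum inL nrm T lam -> Cmod lam <= s.
Proof.
  intros HT Hs Hlt Hess. apply Rnot_lt_le. intros H.
  apply (not_in_ess_spectrum T n lam) in Hess; trivial.
  - eapply Rlt_le_trans; [exact Hlt|]. apply pow_incr. lra.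
  - intros ->. rewrite Cmod_0 in H. lra.
Qed.

Lemma rho_ess_le T n s : bop T -> 0 < s -> gam (Nat.iter n T) < s ^ n ->
  rho_ess inL nrm T <= s.
Proof.
  intros HT Hs Hlt.
  refine (proj1 (Lub_nonneg _ s (or_introl eq_refl) _)).
  intros x [->|[lam [Hess ->]]]; [lra|]. now apply (ess_spectrum_bound T n).
Qed.

Lemma le_rho_ess T : bop T -> 0 <= rho_ess inL nrm T /\
  forall lam, in_ess_spectrum inL nrm T lam -> Cmod lam <= rho_ess inL nrm T.
Proof.
  intros HT. pose proof (hnc_nonneg T).
  destruct (Lub_nonneg (fun r => r = 0 \/
              exists lam, in_ess_spectrum inL nrm T lam /\ r = Cmod lam) (gam T + 1)
              (or_introl eq_refl)) as [_ H'].
  - intros x [->|[lam [Hess ->]]]; [lra|].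
    (* The first power already bounds the essential spectrum, so the supremum defining [rho_ess] is
       finite and [real] does not replace it by 0. *)
    apply (ess_spectrum_bound T 1); trivial; simpl; [lra|].
    change (Nat.iter 1 T) with (fun x => T x). rewrite (hnc_ext _ T) by easy. lra.
  - split; [apply H'; now left|]. intros lam Hl. apply H'. right. now exists lam.
Qed.

Lemma hnc_id : gam (fun x => x) <= 1.
Proof. apply hnc_le_norm; [apply bop_id|lra|intros; lra]. Qed.

Lemma hnc_iter_mul T n q : bop T -> gam (Nat.iter (n * q) T) <= gam (Nat.iter n T) ^ q.
Proof.
  intros HT. induction q as [|q IH].
  - rewrite Nat.mul_0_r. apply hnc_id.
  - rewrite Nat.mul_succ_r, Nat.add_comm, (hnc_ext _ (fun x => Nat.iter n T (Nat.iter (n * q) T x)))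
      by (intros; apply Nat.iter_add).
    eapply Rle_trans; [apply hnc_comp; now apply bop_iter|]. simpl.
    apply Rmult_le_compat_l; [apply hnc_nonneg|trivial].
Qed.

(** * Geometric sums of positive operators and a positive point of the essential spectrum *)

Lemma opdom_gsum_le U a b : bop U -> opdom U U -> (a <= b)%nat ->
  opdom (gsum U a) (gsum U b).
Proof.
  intros HU Hd Hab. induction Hab as [|b _ IH].
  - induction a as [|a IH]; [intros x y _ _ i; simpl; unfold szero; rewrite Cmod_0; simpl; lra|].
    exact (opdom_plus _ _ _ _ IH (opdom_iter U U a HU Hd)).
  - apply (opdom_ext (fun x => sadd (gsum U a x) szero)); [intros; seq_ring|].
    exact (opdom_plus _ _ _ _ IH (opdom_null _ (opdom_iter U U b HU Hd))).
Qed.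

Lemma opdom_iter_gsum U i n : bop U -> opdom U U -> (i < n)%nat ->
  opdom (Nat.iter i U) (gsum U n).
Proof.
  intros HU Hd Hi. induction Hi as [|n _ IH].
  - apply (opdom_ext (fun x => sadd szero (Nat.iter i U x))); [intros; seq_ring|].
    exact (opdom_plus _ _ _ _ (opdom_null _ (opdom_gsum_le U i i HU Hd (le_n i)))
             (opdom_iter U U i HU Hd)).
  - apply (opdom_ext (fun x => sadd (Nat.iter i U x) szero)); [intros; seq_ring|].
    exact (opdom_plus _ _ _ _ IH (opdom_null _ (opdom_iter U U n HU Hd))).
Qed.

(* The coefficient of [U^i] in the square of the geometric series is [i + 1]. *)
Lemma opdom_gsum_square U i n j : bop U -> opdom U U -> (i < n)%nat -> (j <= S i)%nat ->
  opdom (fun x => sscal (RtoC (INR j)) (Nat.iter i U x)) (fun x => gsum U j (gsum U n x)).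
Proof.
  intros HU Hd Hi. induction j as [|j IH]; intros Hj.
  - intros x y _ _ k. simpl. unfold sscal, szero. rewrite Cmult_0_l, Cmod_0. simpl. lra.
  - apply (opdom_ext (fun x => sadd (sscal (RtoC (INR j)) (Nat.iter i U x)) (Nat.iter i U x))).
    + intros x. rewrite S_INR, RtoC_plus. seq_ring.
    + apply (opdom_plus _ (fun x => gsum U j (gsum U n x)) _
               (fun x => Nat.iter j U (gsum U n x))); [apply IH; lia|].
      (* Split [U^i] as [U^j] after [U^(i-j)]; the latter is a term of [gsum U n]. Each term of the
         outer sum thus contributes one copy of [U^i]. *)
      apply (opdom_ext (fun x => Nat.iter j U (Nat.iter (i - j) U x))).
      * intros x. rewrite <- Nat.iter_add. f_equal. lia.
      * apply opdom_comp.
        -- intros x Hx. apply bop_in; [now apply bop_gsum|trivial].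
        -- now apply opdom_iter.
        -- apply opdom_iter_gsum; trivial. lia.
Qed.

Lemma hpow_root a n : 0 <= a -> (0 < n)%nat -> hpow a (/ INR n) ^ n = a.
Proof.
  intros Ha Hn. assert (HI : 0 < INR n) by now apply lt_0_INR.
  destruct Ha as [Ha|<-].
  - unfold hpow. destruct (Rle_dec a 0); [lra|].
    rewrite <- Rpower_pow by apply exp_pos. rewrite Rpower_mult, Rinv_l, Rpower_1; lra.
  - rewrite hpow_0 by lra. apply pow_i. trivial.
Qed.

(** Let [U = T / lam] and let [p] be the sum to be bounded. From [(r - T) S = 1 + K] one gets
    [1 = lam (1 - U) S - (lam - r) S - K]. Applying [p] gives [p = lam (S - U^n S) - (lam - r) p S -
    p K]. The first term has measure at most [2 * lam * C] because [U^n] has measure at most 1, the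
    last has measure 0, and the middle one is at most half of the measure of [p] and is absorbed.
    This produces the factor 4, with no dependence on [n]. *)
Lemma resolvent_partial_sum_bound T S r C lam n :
  bop T -> bop S -> 0 < r < lam -> 0 < C -> gam S <= C -> (lam - r) * C <= / 2 ->
  is_compact_op inL nrm (fun x => ssub (ssub (sscal (RtoC r) (S x)) (T (S x))) x) ->
  gam (Nat.iter n T) <= lam ^ n ->
  gam (gsum (fun x => sscal (RtoC (/ lam)) (T x)) n) <= 4 * lam * C.
Proof.
  intros HT HS Hr HC HSC Hlam HK Hn.
  set (U := fun x => sscal (RtoC (/ lam)) (T x)). set (p := gsum U n).
  set (K := fun x => ssub (ssub (sscal (RtoC r) (S x)) (T (S x))) x) in *.
  assert (HU : bop U) by now apply bop_scale.
  assert (Hp : bop p) by now apply bop_gsum.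
  assert (HKb : bop K) by apply HK.
  assert (HUn : gam (Nat.iter n U) <= 1).
  { rewrite (hnc_ext _ (fun x => sscal (Cpow (RtoC (/ lam)) n) (Nat.iter n T x)))
      by (intros; now apply iter_scale).
    eapply Rle_trans; [apply hnc_scal; now apply bop_iter|].
    assert (0 < / lam) by (apply Rinv_0_lt_compat; lra).
    rewrite Cmod_pow, Cmod_R, Rabs_pos_eq, pow_inv by lra.
    assert (0 < lam ^ n) by (apply pow_lt; lra).
    apply (Rmult_le_reg_l (lam ^ n)); trivial. rewrite <- Rmult_assoc, Rinv_r; lra. }
  assert (E : forall x, inL x -> p x =
    ssub (ssub (sscal (RtoC lam) (ssub (S x) (Nat.iter n U (S x))))
               (sscal (RtoC (lam - r)) (p (S x)))) (p (K x))).
  { intros x Hx. assert (HSx : inL (S x)) by now apply bop_in.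
    assert (HTx : inL (T (S x))) by now apply bop_in.
    assert (HKx : inL (K x)) by now apply bop_in.
    unfold p at 2 3. rewrite <- gsum_left by trivial. fold p.
    assert (HUx : inL (ssub (S x) (U (S x)))) by auto using inL_sub, bop_in.
    rewrite <- !(bop_scal p), <- !(bop_sub p) by auto using inL_sub, inL_scal. f_equal.
    unfold K, U. seq_ring. rewrite RtoC_minus, RtoC_inv by lra. field.
    intros E. apply RtoC_inj in E. lra. }
  assert (Hb1 : bop (fun x => ssub (S x) (Nat.iter n U (S x)))).
  { apply (bop_minus S (fun x => Nat.iter n U (S x))); trivial. apply bop_comp; trivial.
    now apply bop_iter. }
  assert (H1 : gam (fun x => ssub (S x) (Nat.iter n U (S x))) <= 2 * C).
  { eapply Rle_trans.
    - apply (hnc_minus S (fun x => Nat.iter n U (S x))); trivial.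
      apply bop_comp; trivial. now apply bop_iter.
    - assert (gam (fun x => Nat.iter n U (S x)) <= gam (Nat.iter n U) * gam S)
        by (apply hnc_comp; trivial; now apply bop_iter).
      pose proof (hnc_nonneg S). pose proof (hnc_nonneg (Nat.iter n U)). nra. }
  assert (Hb2 : bop (fun x => p (S x))) by now apply bop_comp.
  assert (Hb3 : bop (fun x => p (K x))) by now apply bop_comp.
  assert (H2 : gam (fun x => p (S x)) <= gam p * C).
  { eapply Rle_trans; [now apply hnc_comp|]. apply Rmult_le_compat_l; [apply hnc_nonneg|trivial]. }
  assert (H3 : gam (fun x => p (K x)) <= 0).
  { eapply Rle_trans; [now apply hnc_comp|]. rewrite (hnc_compact K) by trivial. lra. }
  assert (H : gam p <= lam * (2 * C) + (lam - r) * (gam p * C) + 0).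
  { rewrite (hnc_ext p _ E) at 1.
    eapply Rle_trans; [apply hnc_minus; trivial; apply bop_minus; now apply bop_scale|].
    apply Rplus_le_compat; trivial.
    eapply Rle_trans; [apply hnc_minus; now apply bop_scale|].
    apply Rplus_le_compat.
    - eapply Rle_trans; [now apply hnc_scal|]. rewrite Cmod_R, Rabs_pos_eq by lra.
      apply Rmult_le_compat_l; lra.
    - eapply Rle_trans; [now apply hnc_scal|]. rewrite Cmod_R, Rabs_pos_eq by lra.
      apply Rmult_le_compat_l; lra. }
  pose proof (hnc_nonneg p). nra.
Qed.

(* Pringsheim-type argument: if [r - T] had a Calkin inverse, the partial sums [p] of the
   geometric series of [T / lam] would be bounded as [lam] decreases to [r], while by
   positivity [p^2 >= (i + 1) (T / lam)^i], whose measure is at least [(i + 1) (r / lam)^i]. *)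
Lemma positive_ess_spectral_point T r : bop T -> opdom T T -> 0 < r ->
  (forall n, (0 < n)%nat -> r ^ n <= gam (Nat.iter n T)) ->
  (forall lam, r < lam -> exists n, (0 < n)%nat /\ gam (Nat.iter n T) < lam ^ n) ->
  in_ess_spectrum inL nrm T (RtoC r).
Proof.
  intros HT Hd Hr Hlow Hup [S (HS & _ & HK)].
  pose proof (hnc_nonneg S). set (C := gam S + 1). assert (HC : 0 < C) by (unfold C; lra).
  assert (Hkey : forall lam i, r < lam -> (lam - r) * C <= / 2 -> (0 < i)%nat ->
            INR (i + 1) * r ^ i <= (4 * lam * C) ^ 2 * lam ^ i).
  { intros lam i Hl1 Hl2 Hi. destruct (Hup lam Hl1) as [n0 [Hn0 Hlt]].
    (* A multiple of [n0] inherits the bound by [lam ^ n], and the factor [i + 1] makes [n] larger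
       than [i]. *)
    set (n := (n0 * (i + 1))%nat). assert (Hin : (i < n)%nat) by (unfold n; nia).
    set (U := fun x => sscal (RtoC (/ lam)) (T x)).
    assert (Hil : 0 < / lam) by (apply Rinv_0_lt_compat; lra).
    assert (HU : bop U) by now apply bop_scale.
    assert (HdU : opdom U U) by (apply opdom_scale; [lra|trivial]).
    assert (Hp : gam (gsum U n) <= 4 * lam * C).
    { apply (resolvent_partial_sum_bound T S r); trivial; [lra|unfold C; lra|].
      unfold n. eapply Rle_trans; [now apply hnc_iter_mul|]. rewrite pow_mult.
      apply pow_incr. split; [apply hnc_nonneg|lra]. }
    assert (Hp' : gam (gsum U (Datatypes.S i)) <= gam (gsum U n)).
    { apply hnc_mono; auto using bop_gsum. apply opdom_gsum_le; trivial. }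
    assert (Hsq : INR (i + 1) * gam (Nat.iter i U) <= (4 * lam * C) ^ 2).
    { replace (INR (i + 1)) with (Cmod (RtoC (INR (Datatypes.S i)))).
      2:{ rewrite Cmod_R, Rabs_pos_eq by apply pos_INR. f_equal. lia. }
      rewrite <- hnc_scal_eq.
      - apply Rle_trans with (gam (fun x => gsum U (Datatypes.S i) (gsum U n x))).
        + apply hnc_mono; [now apply bop_scale, bop_iter|apply bop_comp; now apply bop_gsum|].
          apply opdom_gsum_square; trivial.
        + eapply Rle_trans; [apply hnc_comp; now apply bop_gsum|].
          pose proof (hnc_nonneg (gsum U (Datatypes.S i))).
          replace ((4 * lam * C) ^ 2) with ((4 * lam * C) * (4 * lam * C)) by ring.
          apply Rmult_le_compat; lra.
      - now apply bop_iter.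
      - intros E. apply RtoC_inj in E. rewrite S_INR in E. pose proof (pos_INR i). lra. }
    assert (HUi : gam (Nat.iter i U) = / lam ^ i * gam (Nat.iter i T)).
    { rewrite (hnc_ext _ (fun x => sscal (Cpow (RtoC (/ lam)) i) (Nat.iter i T x)))
        by (intros; now apply iter_scale).
      rewrite hnc_scal_eq.
      - now rewrite Cmod_pow, Cmod_R, Rabs_pos_eq, pow_inv by lra.
      - now apply bop_iter.
      - apply Cpow_nz. intros E. apply RtoC_inj in E. lra. }
    assert (Hli : 0 < lam ^ i) by (apply pow_lt; lra).
    rewrite HUi in Hsq. specialize (Hlow i Hi).
    apply Rle_trans with (INR (i + 1) * gam (Nat.iter i T)).
    - apply Rmult_le_compat_l; [apply pos_INR|trivial].
    - replace (INR (i + 1) * gam (Nat.iter i T))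
        with (INR (i + 1) * (/ lam ^ i * gam (Nat.iter i T)) * lam ^ i) by (field; lra).
      apply Rmult_le_compat_r; [lra|trivial]. }
  (* The values of [lam] between [r] and [r + e] are those with [(lam - r) * C <= / 2]. On this
     range [(4 * lam * C) ^ 2] is at most half of [B]; the factor 2 in [B] leaves room for the power
     [i] of [lam / r]. *)
  set (e := / (2 * C)).
  assert (He : 0 < e) by (apply Rinv_0_lt_compat; lra).
  set (B := 2 * (4 * (r + e) * C) ^ 2).
  assert (HB : 0 <= B) by (unfold B; pose proof (pow2_ge_0 (4 * (r + e) * C)); lra).
  destruct (nfloor_ex B HB) as [i0 [_ Hi0]]. set (i := Datatypes.S i0).
  (* The exponent [i > B] is fixed before [lam = r * x]. Then [x] is taken so close to 1 that
     [x ^ i <= 2] and [lam <= r + e]; the key estimate becomes [i + 1 <= B], a contradiction. *)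
  set (x := Rmin (hpow 2 (/ INR i)) (1 + e / r)).
  assert (HIi : 0 < / INR i) by (apply Rinv_0_lt_compat, lt_0_INR; unfold i; lia).
  assert (Her : 0 < e / r) by (apply Rdiv_lt_0_compat; lra).
  assert (Hx1 : 1 < x).
  { apply Rmin_glb_lt; [|lra]. rewrite <- (hpow_1 (/ INR i)) at 1. apply hpow_lt; lra. }
  assert (Hxi : x ^ i <= 2).
  { rewrite <- (hpow_root 2 i) by (lra || (unfold i; lia)). apply pow_incr.
    split; [lra|apply Rmin_l]. }
  assert (Hrx : r * x <= r + e).
  { replace (r + e) with (r * (1 + e / r)) by (field; lra).
    apply Rmult_le_compat_l; [lra|apply Rmin_r]. }
  assert (Hl : r < r * x) by nra.
  specialize (Hkey (r * x) i Hl). rewrite (Rpow_mult_distr r x) in Hkey.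
  assert (Hri : 0 < r ^ i) by now apply pow_lt.
  assert (Hkey' : INR (i + 1) * r ^ i <= B * r ^ i).
  { eapply Rle_trans; [apply Hkey; [|unfold i; lia]|].
    - replace (/ 2) with (e * C) by (unfold e; field; lra).
      apply Rmult_le_compat_r; lra.
    - assert ((4 * (r * x) * C) ^ 2 <= (4 * (r + e) * C) ^ 2) by (apply pow_incr; nra).
      pose proof (pow2_ge_0 (4 * (r * x) * C)).
      assert ((4 * (r * x) * C) ^ 2 * x ^ i <= B).
      { unfold B. rewrite (Rmult_comm 2). apply Rmult_le_compat; trivial.
        apply pow_le; lra. }
      replace ((4 * (r * x) * C) ^ 2 * (r ^ i * x ^ i))
        with ((4 * (r * x) * C) ^ 2 * x ^ i * r ^ i) by ring.
      apply Rmult_le_compat_r; lra. }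
  apply Rmult_le_reg_r in Hkey'; trivial.
  unfold i in Hkey'. rewrite plus_INR, S_INR in Hkey'. simpl in Hkey'. lra.
Qed.

(** Let [r] be the infimum of the roots. If it exceeded the essential spectral radius it would be
    positive, and [positive_ess_spectral_point] would put [r] itself into the essential spectrum.
    Hence [r < s], and some root lies below [s]. *)
Lemma hnc_iter_lt_of_rho_ess T s : bop T -> opdom T T -> rho_ess inL nrm T < s ->
  exists n, (0 < n)%nat /\ gam (Nat.iter n T) < s ^ n.
Proof.
  intros HT Hd Hs. destruct (le_rho_ess T HT) as [Hrho Hspec].
  set (root := fun n => hpow (gam (Nat.iter n T)) (/ INR n)).
  set (E := fun x => exists n, (0 < n)%nat /\ x = root n).
  destruct (Glb_nonneg E) as (Hr0 & Hlow & Hup).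
  - exists (root 1%nat). exists 1%nat. split; [lia|easy].
  - intros x [n [_ ->]]. apply hpow_nonneg.
  - set (r := real (Glb_Rbar E)) in *.
    assert (Hlow' : forall n, (0 < n)%nat -> r ^ n <= gam (Nat.iter n T)).
    { intros n Hn. rewrite <- (hpow_root (gam (Nat.iter n T)) n) by (trivial; apply hnc_nonneg).
      apply pow_incr. split; trivial. apply Hlow. now exists n. }
    assert (Hup' : forall lam, r < lam ->
              exists n, (0 < n)%nat /\ gam (Nat.iter n T) < lam ^ n).
    { intros lam Hl. destruct (Hup lam Hl) as [x [[n [Hn ->]] Hlt]]. exists n. split; trivial.
      rewrite <- (hpow_root (gam (Nat.iter n T)) n) by (trivial; apply hnc_nonneg).
      fold (root n). apply pow_lt_compat; trivial. split; [apply hpow_nonneg|trivial]. }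
    apply Hup'. destruct (Rle_lt_dec r (rho_ess inL nrm T)) as [|Hlt]; [lra|].
    assert (Hess : in_ess_spectrum inL nrm T (RtoC r))
      by (apply positive_ess_spectral_point; trivial; lra).
    apply Hspec in Hess. rewrite Cmod_R, Rabs_pos_eq in Hess; lra.
Qed.

(** * Nonnegative matrices *)

Definition opmat (A : mat) : Prop := nonneg_mat N A /\ defines_op N inL A.

(** A termwise comparison with the series for [B]. [mat_app] sums over all naturals while entries in
    columns outside the index set are arbitrary; those terms vanish because [y], and with it [x], is
    0 there. *)
Lemma mat_app_opdom A B : nonneg_mat N A -> defines_op N inL B ->
  (forall i j, domb N i = true -> domb N j = true -> A i j <= B i j) ->
  opdom (mat_app N A) (mat_app N B) /\
  (forall x i, inL x -> domb N i = true -> ex_series (fun j => A i j * Cmod (x j))).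
Proof.
  intros HA HB HAB.
  assert (Hterm : forall x y i j, inL y -> ldom x y -> domb N i = true ->
            0 <= A i j * Cmod (x j) <= B i j * Cmod (y j) /\
            Cmod (A i j * Re (x j), A i j * Im (x j)) <= B i j * Re (y j)).
  { intros x y i j Hy Hxy Hi. specialize (Hxy j).
    assert (E : Cmod (A i j * Re (x j), A i j * Im (x j)) = Rabs (A i j) * Cmod (x j)).
    { replace (A i j * Re (x j), A i j * Im (x j)) with (Cmult (RtoC (A i j)) (x j)).
      - now rewrite Cmod_mult, Cmod_R.
      - unfold Cmult, RtoC, Re, Im. simpl. f_equal; ring. }
    rewrite E. pose proof (Cmod_ge_0 (x j)). pose proof (re_le_Cmod (y j)) as Hre.
    pose proof (Rle_abs (Re (y j))).
    destruct (domb N j) eqn:Hj.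
    - specialize (HA i j Hi Hj). specialize (HAB i j Hi Hj). rewrite Rabs_pos_eq by trivial.
      split; [split; [now apply Rmult_le_pos|]|]; apply Rmult_le_compat; lra.
    - rewrite (inL_out y j) in * by trivial. rewrite Cmod_0. simpl in Hxy.
      replace (Cmod (x j)) with 0 by lra. simpl. lra. }
  assert (Hex : forall x y i, inL y -> ldom x y -> domb N i = true ->
            ex_series (fun j => A i j * Cmod (x j))).
  { intros x y i Hy Hxy Hi.
    apply (ex_series_le (V := R_CompleteNormedModule)) with (fun j => B i j * Cmod (y j)).
    - intros j. destruct (Hterm x y i j Hy Hxy Hi) as [H _].
      change (Rabs (A i j * Cmod (x j)) <= B i j * Cmod (y j)). rewrite Rabs_pos_eq; lra.
    - now apply HB. }
  split.
  - intros x y Hy Hxy i. unfold mat_app. destruct (domb N i) eqn:Hi; [|rewrite Cmod_0; simpl; lra].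
    change (Cmod (Series (fun j => A i j * Re (x j)), Series (fun j => A i j * Im (x j)))
            <= Series (fun j => B i j * Re (y j))).
    assert (Hpart : forall f : C -> R, (forall z, Rabs (f z) <= Cmod z) ->
              ex_series (fun j => A i j * f (x j))).
    { intros f Hf.
      apply (ex_series_le (V := R_CompleteNormedModule)) with (2 := Hex x y i Hy Hxy Hi).
      intros j. change (Rabs (A i j * f (x j)) <= A i j * Cmod (x j)).
      destruct (domb N j) eqn:Hj.
      - rewrite Rabs_mult, Rabs_pos_eq by auto. apply Rmult_le_compat_l; auto.
      - destruct (Hterm x y i j Hy Hxy Hi) as [[H1 H2] _].
        rewrite (inL_out y j), Cmod_0, Rmult_0_r in H2 by trivial.
        specialize (Hxy j). rewrite (inL_out y j) in Hxy by trivial. simpl in Hxy.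
        pose proof (Cmod_ge_0 (x j)). specialize (Hf (x j)).
        assert (E : f (x j) = 0).
        { apply Rabs_eq_0. pose proof (Rabs_pos (f (x j))). lra. }
        rewrite E, Rmult_0_r, Rabs_R0. trivial. }
    apply Cmod_Series_le.
    + apply (Hpart Re re_le_Cmod).
    + apply (Hpart Im Rabs_snd_le_Cmod).
    + apply (ex_series_le (V := R_CompleteNormedModule)) with (fun j => B i j * Cmod (y j));
        [|now apply HB].
      intros j. change (Rabs (B i j * Re (y j)) <= B i j * Cmod (y j)).
      destruct (domb N j) eqn:Hj.
      * specialize (HA i j Hi Hj). specialize (HAB i j Hi Hj).
        rewrite Rabs_mult, (Rabs_pos_eq (B i j)) by lra.
        apply Rmult_le_compat_l; [lra|apply re_le_Cmod].
      * rewrite (inL_out y j), Cmod_0 by trivial. simpl. rewrite Rmult_0_r, Rabs_R0. lra.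
    + intros j. now apply Hterm.
  - intros x i Hx Hi. destruct (sabs_spec x Hx) as [H _].
    exact (Hex x (sabs x) i H (ldom_sabs x) Hi).
Qed.

Lemma opmat_le A B : nonneg_mat N A -> opmat B ->
  (forall i j, domb N i = true -> domb N j = true -> A i j <= B i j) ->
  opmat A /\ opdom (mat_app N A) (mat_app N B).
Proof.
  intros HA [_ HB] HAB. destruct (mat_app_opdom A B HA HB HAB) as [H1 H2].
  split; [|trivial]. split; [trivial|]. intros x Hx. split; [auto|].
  destruct (sabs_spec x Hx) as [H _].
  apply (ideal_ldom _ (mat_app N B (sabs x))); [now apply HB|].
  apply H1; trivial. apply ldom_sabs.
Qed.

Lemma opmat_opdom A : opmat A -> opdom (mat_app N A) (mat_app N A).
Proof. intros HA. apply opmat_le; [apply HA|trivial|]. intros; lra. Qed.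

Lemma opmat_ex_series A x i (f : C -> R) : opmat A -> inL x -> domb N i = true ->
  f (RtoC 0) = 0 -> (forall z, Rabs (f z) <= Cmod z) -> ex_series (fun j => A i j * f (x j)).
Proof.
  intros [HA HA'] Hx Hi Hf0 Hf.
  apply (ex_series_le (V := R_CompleteNormedModule)) with (2 := proj1 (HA' x Hx) i Hi).
  intros j. change (Rabs (A i j * f (x j)) <= A i j * Cmod (x j)).
  destruct (domb N j) eqn:Hj.
  - rewrite Rabs_mult, Rabs_pos_eq by auto. apply Rmult_le_compat_l; auto.
  - rewrite (inL_out x j), Hf0, Cmod_0, Rmult_0_r, Rabs_R0 by trivial. lra.
Qed.

(** [defines_op] only asks that the action stays in the space; boundedness comes from positivity
    through [positive_op_bounded]. *)
Lemma opmat_bop A : opmat A -> bop (mat_app N A).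
Proof.
  intros HA.
  assert (Hre : forall x i, inL x -> domb N i = true -> ex_series (fun j => A i j * Re (x j)))
    by (intros; apply (opmat_ex_series A x i Re); trivial; apply re_le_Cmod).
  assert (Him : forall x i, inL x -> domb N i = true -> ex_series (fun j => A i j * Im (x j)))
    by (intros; apply (opmat_ex_series A x i Im); trivial; apply Rabs_snd_le_Cmod).
  assert (Hlin : linear_on (mat_app N A)).
  { split; [|split].
    - intros x Hx. now apply HA.
    - intros x y Hx Hy. apply functional_extensionality. intros i. unfold mat_app, sadd at 3.
      destruct (domb N i) eqn:Hi; [|ring].
      unfold Cplus. simpl. rewrite <- !Series_plus by auto.
      f_equal; apply Series_ext; intros j; unfold sadd, Re, Im; simpl; ring.
    - intros c x Hx. apply functional_extensionality. intros i. unfold mat_app, sscal at 3.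
      destruct (domb N i) eqn:Hi; [|ring].
      unfold Cmult. simpl. rewrite <- !Series_scal_l.
      rewrite <- Series_minus, <- Series_plus by now apply @ex_series_scal_l; auto.
      f_equal; apply Series_ext; intros j; unfold sscal, Re, Im; simpl; ring. }
  destruct (positive_op_bounded _ Hlin (opmat_opdom A HA)) as [M HM].
  exact (linear_bop _ M Hlin HM).
Qed.

Lemma mat_app_unitvec A i j : domb N i = true -> mat_app N A (unitvec j) i = RtoC (A i j).
Proof.
  intros Hi. unfold mat_app. rewrite Hi. unfold RtoC. f_equal.
  - rewrite <- (is_series_unique _ _ (is_series_single (A i) j)). apply Series_ext.
    intros l. unfold unitvec. destruct (Nat.eqb l j); simpl; ring.
  - rewrite <- Series_zero. apply Series_ext.
    intros l. unfold unitvec. destruct (Nat.eqb l j); simpl; ring.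
Qed.

(* By order continuity [T x] is the limit of [T (trunc n x)], whose entries are the partial
   sums of the matrix action; no exchange of double series is needed for products. *)
Lemma opmat_of_op T M : bop T -> opdom T T ->
  (forall i j, domb N i = true -> domb N j = true -> T (unitvec j) i = RtoC (M i j)) ->
  opmat M /\ (forall x, inL x -> mat_app N M x = T x).
Proof.
  intros HT Hd HM.
  assert (Hpart : forall x i n, inL x -> domb N i = true ->
    T (trunc (S n) x) i = (sum_n (fun j => M i j * Re (x j)) n,
                           sum_n (fun j => M i j * Im (x j)) n)).
  { intros x i n Hx Hi.
    assert (Hstep : forall j, T (sscal (x j) (unitvec j)) i
                              = (M i j * Re (x j), M i j * Im (x j))).
    { intros j. destruct (domb N j) eqn:Hj.
      - rewrite (bop_scal T) by auto using inL_unitvec. unfold sscal. rewrite HM by trivial.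
        unfold Cmult, RtoC, Re, Im. simpl. f_equal; ring.
      - rewrite (inL_out x j) by trivial.
        replace (sscal 0 (unitvec j)) with szero by seq_ring. rewrite bop_zero by trivial.
        unfold szero, RtoC. simpl. f_equal; ring. }
    induction n as [|n IH].
    - rewrite trunc_S, trunc_0, !sum_O, <- Hstep. f_equal. f_equal. seq_ring.
    - rewrite trunc_S, (bop_add T) by (trivial; apply trunc_spec || apply inL_coord_unitvec; trivial).
      unfold sadd at 1. rewrite IH, Hstep, !sum_Sn. reflexivity. }
  (* [f] stands for [Re] or [Im]. The error is a coordinate of the image of a tail, hence at most
     the bound of [T] times the norm of that tail. *)
  assert (Hlim : forall x i (f : C -> R), inL x ->
    (forall z w, Rabs (f z - f w) <= Cmod (Cminus z w)) ->
    is_lim_seq (fun n => f (T (trunc (S n) x) i)) (f (T x i))).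
  { intros x i f Hx Hf. destruct (bop_bound T HT) as [B [HB HB']].
    apply is_lim_seq_spec. intros [eps He].
    destruct (tail_vanishes x (eps / B) Hx) as [n0 Hn0]; [now apply Rdiv_lt_0_compat|].
    exists n0. intros n Hn. simpl. specialize (Hn0 (S n) ltac:(lia)).
    destruct (tail_spec (S n) x Hx) as [Ht _]. destruct (trunc_spec (S n) x Hx) as [Ht' _].
    eapply Rle_lt_trans; [apply Hf|].
    replace (Cminus (T (trunc (S n) x) i) (T x i)) with (Copp (T (tail (S n) x) i)).
    - rewrite Cmod_opp. eapply Rle_lt_trans; [apply coord_le; now apply bop_in|].
      eapply Rle_lt_trans; [now apply HB'|]. replace eps with (B * (eps / B)) by (field; lra).
      now apply Rmult_lt_compat_l.
    - rewrite (trunc_add_tail (S n) x) at 3. rewrite (bop_add T) by trivial.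
      unfold sadd. ring. }
  assert (Hre : forall x i, inL x -> domb N i = true ->
            is_series (fun j => M i j * Re (x j)) (Re (T x i))).
  { intros x i Hx Hi.
    change (is_lim_seq (sum_n (fun j => M i j * Re (x j))) (Re (T x i))).
    apply (is_lim_seq_ext (fun n => Re (T (trunc (S n) x) i))).
    - intros n. now rewrite Hpart.
    - apply Hlim; trivial. intros z w. apply (re_le_Cmod (Cminus z w)). }
  assert (Him : forall x i, inL x -> domb N i = true ->
            is_series (fun j => M i j * Im (x j)) (Im (T x i))).
  { intros x i Hx Hi.
    change (is_lim_seq (sum_n (fun j => M i j * Im (x j))) (Im (T x i))).
    apply (is_lim_seq_ext (fun n => Im (T (trunc (S n) x) i))).
    - intros n. now rewrite Hpart.
    - apply Hlim; trivial. intros z w. apply (Rabs_snd_le_Cmod (Cminus z w)). }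
  assert (Happ : forall x, inL x -> mat_app N M x = T x).
  { intros x Hx. apply functional_extensionality. intros i. unfold mat_app.
    destruct (domb N i) eqn:Hi.
    - rewrite (is_series_unique _ _ (Hre x i Hx Hi)), (is_series_unique _ _ (Him x i Hx Hi)).
      now destruct (T x i).
    - symmetry. apply inL_out; auto using bop_in. }
  split; [|trivial]. split.
  - intros i j Hi Hj. assert (Hu : ldom (unitvec j) (unitvec j)).
    { intros l. unfold unitvec. destruct (Nat.eqb l j); rewrite ?Cmod_0, ?Cmod_1; simpl; lra. }
    pose proof (ldom_refl_nonneg _ _ (Hd _ _ (inL_unitvec j Hj) Hu) i) as H.
    now rewrite HM in H.
  - intros x Hx. split; [|rewrite Happ by trivial; now apply bop_in].
    intros i Hi. destruct (sabs_spec x Hx) as [H _]. exists (Re (T (sabs x) i)).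
    exact (Hre (sabs x) i H Hi).
Qed.

Lemma opmat_mul A B : opmat A -> opmat B ->
  opmat (mat_mul N A B) /\
  (forall x, inL x -> mat_app N (mat_mul N A B) x = mat_app N A (mat_app N B x)).
Proof.
  intros HA HB. pose proof (opmat_bop A HA) as HA'. pose proof (opmat_bop B HB) as HB'.
  apply (opmat_of_op (fun x => mat_app N A (mat_app N B x))).
  - now apply bop_comp.
  - apply opdom_comp; auto using opmat_opdom, bop_in.
  - intros i j Hi Hj.
    assert (E : forall l, mat_app N B (unitvec j) l = RtoC (if domb N l then B l j else 0)).
    { intros l. destruct (domb N l) eqn:Hl; [now apply mat_app_unitvec|].
      unfold mat_app. now rewrite Hl. }
    unfold mat_app at 1. rewrite Hi. unfold RtoC, mat_mul. f_equal.
    + apply Series_ext. intros l. rewrite E. destruct (domb N l); simpl; ring.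
    + rewrite <- Series_zero. apply Series_ext. intros l. rewrite E. simpl. ring.
Qed.

Lemma opmat_mul_ex_series A B i j : opmat A -> opmat B -> domb N i = true -> domb N j = true ->
  ex_series (fun l => if domb N l then A i l * B l j else 0).
Proof.
  intros HA HB Hi Hj.
  assert (HBj : inL (mat_app N B (unitvec j))) by (apply HB; now apply inL_unitvec).
  apply (ex_series_ext (fun l => A i l * Re (mat_app N B (unitvec j) l))).
  - intros l. destruct (domb N l) eqn:Hl.
    + rewrite mat_app_unitvec by trivial. easy.
    + unfold mat_app. rewrite Hl. simpl. ring.
  - apply (opmat_ex_series A _ i Re); trivial. apply re_le_Cmod.
Qed.

Lemma opmat_id : opmat mat_id /\ (forall x, inL x -> mat_app N mat_id x = x).
Proof.
  apply (opmat_of_op (fun x => x)); [apply bop_id|now intros x y|].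
  intros i j _ _. unfold unitvec, mat_id. now destruct (Nat.eqb i j).
Qed.

Lemma opmat_prod k F : (forall i, (i < k)%nat -> opmat (F i)) -> opmat (mat_prod N k F).
Proof.
  induction k as [|k IH]; intros H; [apply opmat_id|].
  apply opmat_mul; auto.
Qed.

Lemma mat_app_power A n x : opmat A -> inL x ->
  mat_app N (mat_prod N n (fun _ => A)) x = Nat.iter n (mat_app N A) x.
Proof.
  intros HA. revert x. induction n as [|n IH]; intros x Hx; [now apply opmat_id|].
  simpl mat_prod. rewrite (proj2 (opmat_mul _ A (opmat_prod n _ (fun _ _ => HA)) HA)) by trivial.
  rewrite IH by (apply bop_in; [now apply opmat_bop|trivial]). apply iter_swap.
Qed.

Lemma opmat_axpy A B c : opmat A -> opmat B -> 0 <= c ->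
  opmat (fun i j => A i j + c * B i j) /\
  (forall x, inL x -> mat_app N (fun i j => A i j + c * B i j) x
                      = sadd (mat_app N A x) (sscal (RtoC c) (mat_app N B x))).
Proof.
  intros HA HB Hc. pose proof (opmat_bop A HA) as HA'. pose proof (opmat_bop B HB) as HB'.
  apply (opmat_of_op (fun x => sadd (mat_app N A x) (sscal (RtoC c) (mat_app N B x)))).
  - now apply bop_plus; [|apply bop_scale].
  - apply opdom_plus; [now apply opmat_opdom|]. now apply opdom_scale; [|apply opmat_opdom].
  - intros i j Hi Hj. unfold sadd, sscal. rewrite !mat_app_unitvec by trivial.
    now rewrite RtoC_plus, RtoC_mult.
Qed.

Lemma opmat_lincomb m a F c :
  (forall j, (j < m)%nat -> 0 <= a j /\ opmat (F j) /\
     forall x, inL x -> nrm (mat_app N (F j) x) <= c j * nrm x) ->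
  opmat (fun i l => Rsum m (fun j => a j * F j i l)) /\
  (forall x, inL x -> nrm (mat_app N (fun i l => Rsum m (fun j => a j * F j i l)) x)
                      <= Rsum m (fun j => a j * c j) * nrm x).
Proof.
  induction m as [|m IH]; intros H; simpl.
  - destruct (opmat_of_op (fun _ => szero) (fun _ _ => 0)) as [H1 H2].
    + apply bop_null.
    + intros x y _ _ i. unfold szero. rewrite Cmod_0. simpl. lra.
    + easy.
    + split; trivial. intros x Hx. rewrite H2, nrm_zero by trivial. lra.
  - destruct IH as [IH1 IH2]; [auto|]. destruct (H m) as (Ha & HF & Hc); [lia|].
    destruct (opmat_axpy _ (F m) (a m) IH1 HF Ha) as [H1 H2]. split; trivial.
    intros x Hx. rewrite H2 by trivial.
    assert (HFx : inL (mat_app N (F m) x)) by (apply HF; trivial).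
    eapply Rle_trans; [apply nrm_add; [apply IH1|apply inL_scal]; trivial|].
    rewrite nrm_scal, Cmod_R, Rabs_pos_eq, Rmult_plus_distr_r, Rmult_assoc by trivial.
    apply Rplus_le_compat; [auto|]. apply Rmult_le_compat_l; auto.
Qed.

(** * Norm and measure of noncompactness of Hadamard products *)

Lemma nonneg_hadam m F alpha : nonneg_mat N (hadam m F alpha).
Proof. intros i j _ _. apply Rprod_nonneg. intros. apply hpow_nonneg. Qed.

(** The entry is a coordinate of the image of a unit vector; norm 1 of the unit vectors is used once
    for [j] and, through [coord_le], once for [i]. *)
Lemma entry_le_norm A c i j : opmat A -> (forall x, inL x -> nrm (mat_app N A x) <= c * nrm x) ->
  domb N i = true -> domb N j = true -> A i j <= c.
Proof.
  intros HA Hc Hi Hj. pose proof (inL_unitvec j Hj) as Hu. specialize (Hc _ Hu).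
  rewrite nrm_unitvec, Rmult_1_r in Hc by trivial.
  pose proof (coord_le (mat_app N A (unitvec j)) i (proj2 (proj2 HA _ Hu))) as H.
  rewrite mat_app_unitvec, Cmod_R in H by trivial. pose proof (Rle_abs (A i j)). lra.
Qed.

(** The Hadamard product lies entrywise below the combination of the [F j] with the coefficients of
    [hadamard_entry_le]. The norm of that combination is at most the sum of the [a j * c j], and the
    coefficients are such that this sum is [K]. *)
Lemma hadam_norm_bound m F alpha c :
  (forall j, (j < m)%nat -> 0 < c j /\ opmat (F j) /\
     forall x, inL x -> nrm (mat_app N (F j) x) <= c j * nrm x) ->
  (forall j, (j < m)%nat -> 0 < alpha j) -> 1 <= Rsum m alpha ->
  opmat (hadam m F alpha) /\
  (forall x, inL x -> nrm (mat_app N (hadam m F alpha) x)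
     <= Rprod m (fun j => hpow (c j) (alpha j)) * nrm x).
Proof.
  intros HF Ha Hs. set (K := Rprod m (fun j => hpow (c j) (alpha j))).
  set (a := fun j => K * (alpha j / Rsum m alpha * / c j)).
  assert (HK : 0 <= K) by (apply Rprod_nonneg; intros; apply hpow_nonneg).
  destruct (opmat_lincomb m a F c) as [HG HG'].
  { intros j Hj. destruct (HF j Hj) as (H1 & H2 & H3). split; [|now split].
    apply Rmult_le_pos; trivial. specialize (Ha j Hj). left.
    apply Rmult_lt_0_compat; [apply Rdiv_lt_0_compat; lra|now apply Rinv_0_lt_compat]. }
  assert (EK : Rsum m (fun j => a j * c j) = K).
  { rewrite (Rsum_ext m _ (fun j => K * / Rsum m alpha * alpha j)).
    - rewrite Rsum_scal. field. lra.
    - intros j Hj. destruct (HF j Hj) as (H1 & _). unfold a. field. lra. }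
  destruct (opmat_le (hadam m F alpha) _ (nonneg_hadam m F alpha) HG) as [H1 H2].
  { intros i l Hi Hl. apply (hadamard_entry_le m (fun j => F j i l)); trivial.
    - intros j Hj. destruct (HF j Hj) as (_ & H2 & H3). split; [now apply H2|].
      apply (entry_le_norm (F j)); trivial.
    - intros j Hj. now apply HF. }
  split; trivial. apply (opdom_norm _ _ K (opmat_bop _ HG) H2).
  rewrite EK in HG'. exact HG'.
Qed.

Lemma opmat_hadam m F alpha : (forall j, (j < m)%nat -> opmat (F j)) ->
  (forall j, (j < m)%nat -> 0 < alpha j) -> 1 <= Rsum m alpha -> opmat (hadam m F alpha).
Proof.
  intros HF Ha Hs.
  assert (Hc : forall j, exists c, (j < m)%nat -> 0 < c /\
            forall x, inL x -> nrm (mat_app N (F j) x) <= c * nrm x).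
  { intros j. destruct (Nat.lt_ge_cases j m) as [Hj|Hj]; [|exists 0; lia].
    destruct (bop_bound _ (opmat_bop _ (HF j Hj))) as [c Hc]. now exists c. }
  apply choice in Hc. destruct Hc as [c Hc].
  apply (hadam_norm_bound m F alpha c); trivial.
  intros j Hj. destruct (Hc j Hj). auto.
Qed.

Definition tail_mat (n : nat) (A : mat) : mat := fun i j => if Nat.ltb i n then 0 else A i j.

Lemma opmat_tail n A : opmat A ->
  opmat (tail_mat n A) /\ (forall x, inL x -> mat_app N (tail_mat n A) x = tail n (mat_app N A x)).
Proof.
  intros HA. apply (opmat_of_op (fun x => tail n (mat_app N A x))).
  - now apply bop_tail, opmat_bop.
  - now apply opdom_tail, opmat_opdom.
  - intros i j Hi Hj. unfold tail, tail_mat. rewrite mat_app_unitvec by trivial.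
    now destruct (Nat.ltb i n).
Qed.

(** Erased rows stay zero because [hpow 0 t] is 0 and there is at least one factor; an empty product
    would put 1 there. *)
Lemma hadam_tail_mat n m F alpha : (0 < m)%nat ->
  hadam m (fun j => tail_mat n (F j)) alpha = tail_mat n (hadam m F alpha).
Proof.
  intros Hm. apply functional_extensionality. intros i. apply functional_extensionality.
  intros j. unfold hadam, tail_mat. destruct (Nat.ltb i n); [|easy].
  apply (Rprod_eq0 m _ 0); trivial. apply hpow_0. lra.
Qed.

Lemma eventually_forall_lt (P : nat -> nat -> Prop) m :
  (forall j, (j < m)%nat -> exists n0, forall n, (n0 <= n)%nat -> P j n) ->
  exists n, forall j, (j < m)%nat -> P j n.
Proof.
  intros H.
  assert (H' : exists n0, forall n, (n0 <= n)%nat -> forall j, (j < m)%nat -> P j n).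
  { induction m as [|m IH]; [exists O; lia|].
    destruct IH as [n1 H1]; [auto|]. destruct (H m) as [n2 H2]; [lia|].
    exists (Nat.max n1 n2). intros n Hn j Hj.
    destruct (Nat.eq_dec j m) as [->|]; [apply H2|apply H1]; lia. }
  destruct H' as [n Hn]. exists n. now apply Hn.
Qed.

(** For [c j] above the measures, one [n] makes the norms of all tails at most [c j]. Tails of
    matrices are matrices and commute with the Hadamard product, so the norm bound applies to
    them. *)
Lemma hnc_hadam m F alpha : (forall j, (j < m)%nat -> opmat (F j)) ->
  (forall j, (j < m)%nat -> 0 < alpha j) -> 1 <= Rsum m alpha ->
  gam (mat_app N (hadam m F alpha))
    <= Rprod m (fun j => hpow (gam (mat_app N (F j))) (alpha j)).
Proof.
  intros HF Ha Hs. apply le_Rprod_hpow; trivial; [intros; apply hnc_nonneg|].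
  intros c Hc.
  destruct (eventually_forall_lt (fun j n => forall x, inL x ->
              nrm (tail n (mat_app N (F j) x)) <= c j * nrm x) m) as [n Hn].
  { intros j Hj. apply tail_norm_of_hnc; auto using opmat_bop. }
  pose proof (opmat_hadam m F alpha HF Ha Hs) as HH.
  destruct (hadam_norm_bound m (fun j => tail_mat n (F j)) alpha c) as [_ H]; trivial.
  { intros j Hj. destruct (opmat_tail n (F j) (HF j Hj)) as [H1 H2].
    split; [|split]; trivial.
    - pose proof (hnc_nonneg (mat_app N (F j))). specialize (Hc j Hj). lra.
    - intros x Hx. rewrite H2; auto. }
  rewrite hadam_tail_mat in H by now apply Rsum_pos_index with alpha.
  apply (hnc_le_tail _ n); [now apply opmat_bop| |].
  - apply Rprod_nonneg. intros. apply hpow_nonneg.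
  - intros x Hx. rewrite <- (proj2 (opmat_tail n _ HH)) by trivial. auto.
Qed.

(* A Hoelder inequality for sums of products, by the same weighted AM-GM scaling. *)
Lemma hadam_mul_le m F G alpha i j :
  (forall l, (l < m)%nat -> opmat (F l)) -> (forall l, (l < m)%nat -> opmat (G l)) ->
  (forall l, (l < m)%nat -> 0 < alpha l) -> 1 <= Rsum m alpha ->
  domb N i = true -> domb N j = true ->
  mat_mul N (hadam m F alpha) (hadam m G alpha) i j
    <= hadam m (fun l => mat_mul N (F l) (G l)) alpha i j.
Proof.
  intros HF HG Ha Hs Hi Hj.
  set (t := fun l p => if domb N p then F l i p * G l p j else 0).
  assert (Ht0 : forall l, (l < m)%nat -> forall p, 0 <= t l p).
  { intros l Hl p. unfold t. destruct (domb N p) eqn:Hp; [|lra].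
    apply Rmult_le_pos; [apply HF|apply HG]; trivial. }
  assert (Hex : forall l, (l < m)%nat -> ex_series (t l))
    by (intros; apply opmat_mul_ex_series; auto).
  assert (Hprod : forall p, domb N p = true ->
    hadam m F alpha i p * hadam m G alpha p j = Rprod m (fun l => hpow (t l p) (alpha l))).
  { intros p Hp. unfold hadam. rewrite <- Rprod_mult. apply Rprod_ext. intros l Hl.
    unfold t. rewrite Hp, hpow_mult; [easy|apply HF|apply HG]; trivial. }
  apply (le_Rprod_hpow _ m (fun l => mat_mul N (F l) (G l) i j)); trivial.
  { intros l Hl. destruct (opmat_mul (F l) (G l) (HF l Hl) (HG l Hl)) as [H _]. now apply H. }
  (* [c l] lies strictly above the sum of the nonnegative series [t l], hence above each of its
     terms and above 0. It plays the part that the norm has for matrices. *)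
  intros c Hc. change (forall l, (l < m)%nat -> Series (t l) < c l) in Hc.
  assert (Htc : forall l, (l < m)%nat -> forall p, t l p <= c l).
  { intros l Hl p. specialize (Hc l Hl).
    pose proof (term_le_Series (t l) p (Ht0 l Hl) (Hex l Hl)). lra. }
  assert (Hc0 : forall l, (l < m)%nat -> 0 < c l).
  { intros l Hl. specialize (Hc l Hl).
    pose proof (term_le_Series (t l) O (Ht0 l Hl) (Hex l Hl)).
    pose proof (Ht0 l Hl O). lra. }
  set (K := Rprod m (fun l => hpow (c l) (alpha l))).
  assert (HK : 0 <= K) by (apply Rprod_nonneg; intros; apply hpow_nonneg).
  set (a := fun l => K * (alpha l / Rsum m alpha * / c l)).
  assert (Ha0 : forall l, (l < m)%nat -> 0 <= a l).
  { intros l Hl. apply Rmult_le_pos; trivial. specialize (Ha l Hl). left.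
    apply Rmult_lt_0_compat; [apply Rdiv_lt_0_compat; lra|apply Rinv_0_lt_compat; auto]. }
  assert (Hser : is_series (fun p => Rsum m (fun l => a l * t l p))
                   (Rsum m (fun l => a l * Series (t l)))).
  { apply (is_series_Rsum m (fun l p => a l * t l p)). intros l Hl.
    apply (is_series_scal_l (a l) (t l)). now apply Series_correct, Hex. }
  apply Rle_trans with (Series (fun p => Rsum m (fun l => a l * t l p))).
  - apply Series_le; [|now exists (Rsum m (fun l => a l * Series (t l)))].
    intros p. destruct (domb N p) eqn:Hp.
    + rewrite Hprod by trivial. split; [apply Rprod_nonneg; intros; apply hpow_nonneg|].
      apply hadamard_entry_le; auto.
    + split; [lra|]. rewrite <- (Rmult_0_l (Rsum m (fun _ => 0))), <- Rsum_scal.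
      apply Rsum_le. intros l Hl. rewrite Rmult_0_r. apply Rmult_le_pos; auto.
  - rewrite (is_series_unique _ _ Hser).
    apply Rle_trans with (Rsum m (fun l => a l * c l)).
    + apply Rsum_le. intros l Hl. apply Rmult_le_compat_l; auto. left; auto.
    + rewrite (Rsum_ext m _ (fun l => K * / Rsum m alpha * alpha l)).
      * rewrite Rsum_scal. right. field. lra.
      * intros l Hl. specialize (Hc0 l Hl). unfold a. field. lra.
Qed.

(** * Products of Hadamard products and the essential spectral radius *)

Lemma mat_prod_hadam_le k m (A : nat -> nat -> mat) alpha :
  (forall i j, (i < k)%nat -> (j < m)%nat -> opmat (A i j)) ->
  (forall j, (j < m)%nat -> 0 < alpha j) -> 1 <= Rsum m alpha ->
  forall i j, domb N i = true -> domb N j = true ->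
    mat_prod N k (fun i => hadam m (A i) alpha) i j
      <= hadam m (fun j => mat_prod N k (fun i => A i j)) alpha i j.
Proof.
  intros HA Ha Hs. induction k as [|k IH]; intros i j Hi Hj.
  - simpl. unfold mat_id, hadam. destruct (Nat.eqb i j).
    + right. clear. induction m as [|m IH]; simpl; [easy|]. rewrite <- IH, hpow_1. ring.
    + apply Rprod_nonneg. intros. apply hpow_nonneg.
  - assert (HP : forall l, (l < m)%nat -> opmat (mat_prod N k (fun i => A i l)))
      by (intros; apply opmat_prod; auto).
    assert (HB : opmat (mat_prod N k (fun i => hadam m (A i) alpha)))
      by (apply opmat_prod; intros; apply opmat_hadam; auto).
    assert (HAk : opmat (hadam m (A k) alpha)) by (apply opmat_hadam; auto).
    set (H := hadam m (fun l => mat_prod N k (fun i => A i l)) alpha) in *.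
    assert (HH : opmat H) by now apply opmat_hadam.
    apply Rle_trans with (mat_mul N H (hadam m (A k) alpha) i j).
    + simpl. apply Series_le; [|now apply opmat_mul_ex_series].
      intros l. destruct (domb N l) eqn:Hl; [|lra]. specialize (IH ltac:(auto) i l Hi Hl).
      assert (0 <= hadam m (A k) alpha l j) by now apply nonneg_hadam.
      assert (0 <= mat_prod N k (fun i => hadam m (A i) alpha) i l) by now apply HB.
      split; [now apply Rmult_le_pos|now apply Rmult_le_compat_r].
    + apply (hadam_mul_le m (fun l => mat_prod N k (fun i => A i l)) (A k)); auto.
Qed.

(** The essential spectra are not compared directly. Positivity of [S] turns its radius into a bound
    for the measure of some power, domination passes this to the same power of [T], and the power
    bounds the radius of [T]. *)
Lemma rho_ess_mono T S : bop T -> bop S -> opdom T S -> opdom S S ->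
  rho_ess inL nrm T <= rho_ess inL nrm S.
Proof.
  intros HT HS Hd HdS. destruct (le_rho_ess S HS) as [H0 _].
  apply le_epsilon. intros eps He.
  destruct (hnc_iter_lt_of_rho_ess S (rho_ess inL nrm S + eps) HS HdS) as [n [_ Hn]]; [lra|].
  apply (rho_ess_le T n); trivial; [lra|]. eapply Rle_lt_trans; [|exact Hn].
  apply hnc_mono; auto using bop_iter. now apply opdom_iter.
Qed.

(** By submultiplicativity a strict bound for one power persists for all its positive multiples, so
    the product of the individual exponents serves all indices. *)
Lemma common_exponent m (T : nat -> seqC -> seqC) c :
  (forall j, (j < m)%nat -> bop (T j) /\
     exists n, (0 < n)%nat /\ gam (Nat.iter n (T j)) < c j ^ n) ->
  exists n, (0 < n)%nat /\ forall j, (j < m)%nat -> gam (Nat.iter n (T j)) < c j ^ n.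
Proof.
  assert (Hmul : forall U b n q, bop U -> (0 < q)%nat -> gam (Nat.iter n U) < b ^ n ->
            gam (Nat.iter (n * q) U) < b ^ (n * q)).
  { intros U b n q HU Hq Hlt. eapply Rle_lt_trans; [now apply hnc_iter_mul|].
    rewrite pow_mult. apply pow_lt_compat; trivial. split; [apply hnc_nonneg|trivial]. }
  induction m as [|m IH]; intros H; [exists 1%nat; split; [|intros]; lia|].
  destruct IH as [n1 [Hn1 H1]]; [auto|]. destruct (H m) as [Hb [n2 [Hn2 H2]]]; [lia|].
  exists (n1 * n2)%nat. split; [lia|]. intros j Hj.
  destruct (Nat.eq_dec j m) as [->|].
  - rewrite (Nat.mul_comm n1). now apply Hmul.
  - apply Hmul; trivial; [now apply H|apply H1; lia].
Qed.

Lemma hnc_power A n : opmat A ->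
  gam (Nat.iter n (mat_app N A)) = gam (mat_app N (mat_prod N n (fun _ => A))).
Proof. intros HA. apply hnc_ext. intros x Hx. symmetry. now apply mat_app_power. Qed.

(** A power of a Hadamard product is a product of equal Hadamard products, so [mat_prod_hadam_le]
    puts it entrywise below the Hadamard product of the powers; then [hnc_mono] and [hnc_hadam]
    apply. *)
Lemma hnc_power_hadam m F alpha n : (forall j, (j < m)%nat -> opmat (F j)) ->
  (forall j, (j < m)%nat -> 0 < alpha j) -> 1 <= Rsum m alpha ->
  gam (Nat.iter n (mat_app N (hadam m F alpha)))
    <= Rprod m (fun j => hpow (gam (Nat.iter n (mat_app N (F j)))) (alpha j)).
Proof.
  intros HF Ha Hs. pose proof (opmat_hadam m F alpha HF Ha Hs) as HH.
  assert (HP : forall j, (j < m)%nat -> opmat (mat_prod N n (fun _ => F j)))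
    by (intros; apply opmat_prod; auto).
  rewrite hnc_power by trivial.
  rewrite (Rprod_ext m _
    (fun j => hpow (gam (mat_app N (mat_prod N n (fun _ => F j)))) (alpha j)))
    by (intros; rewrite hnc_power; auto).
  eapply Rle_trans; [|now apply (hnc_hadam m (fun j => mat_prod N n (fun _ => F j)))].
  pose proof (opmat_hadam m _ alpha HP Ha Hs) as HH'.
  destruct (opmat_le (mat_prod N n (fun _ => hadam m F alpha)) _
              (proj1 (opmat_prod n _ (fun _ _ => HH))) HH') as [H1 H2].
  - apply (mat_prod_hadam_le n m (fun _ => F)); auto.
  - apply hnc_mono; auto using opmat_bop.
Qed.

(** At a common exponent [n] the n-th powers of the factors have measures below [c j ^ n]. The
    measure of the n-th power of the Hadamard product is then strictly below the n-th power of the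
    product of the [hpow (c j) (alpha j)], which is what [rho_ess_le] requires. *)
Lemma rho_ess_hadam m F alpha : (forall j, (j < m)%nat -> opmat (F j)) ->
  (forall j, (j < m)%nat -> 0 < alpha j) -> 1 <= Rsum m alpha ->
  rho_ess inL nrm (mat_app N (hadam m F alpha))
    <= Rprod m (fun j => hpow (rho_ess inL nrm (mat_app N (F j))) (alpha j)).
Proof.
  intros HF Ha Hs. pose proof (opmat_hadam m F alpha HF Ha Hs) as HH.
  assert (Hrho : forall j, (j < m)%nat -> 0 <= rho_ess inL nrm (mat_app N (F j)))
    by (intros; apply le_rho_ess, opmat_bop; auto).
  apply le_Rprod_hpow; trivial. intros c Hc.
  assert (Hc0 : forall j, (j < m)%nat -> 0 < c j).
  { intros j Hj. specialize (Hc j Hj). specialize (Hrho j Hj). lra. }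
  destruct (common_exponent m (fun j => mat_app N (F j)) c) as [n [Hn Hlt]].
  { intros j Hj. split; [auto using opmat_bop|].
    apply hnc_iter_lt_of_rho_ess; auto using opmat_bop, opmat_opdom. }
  apply (rho_ess_le _ n); [now apply opmat_bop|apply Rprod_pos; intros; apply hpow_pos; auto|].
  eapply Rle_lt_trans; [now apply hnc_power_hadam|].
  rewrite <- Rprod_pow. apply Rprod_lt; [now apply Rsum_pos_index with alpha|].
  intros j Hj. split; [apply hpow_nonneg|].
  rewrite <- hpow_pow by (left; auto). apply hpow_lt; auto. split; [apply hnc_nonneg|auto].
Qed.

End BanachSequenceSpace.

Theorem theorem3p5 (N : option nat) (inL : seqC -> Prop) (nrm : seqC -> R)
  (k m : nat) (A : nat -> nat -> mat) (alpha : nat -> R) :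
  in_class_L N inL nrm ->
  order_continuous_L inL nrm ->
  order_continuous_dual inL nrm ->
  (0 < k)%nat ->
  (forall i j, (i < k)%nat -> (j < m)%nat ->
     nonneg_mat N (A i j) /\ defines_op N inL (A i j)) ->
  (forall j, (j < m)%nat -> 0 < alpha j) ->
  1 <= Rsum m alpha ->
  let Abig := mat_prod N k (fun i => hadam m (fun j => A i j) alpha) in
  let P := fun j => mat_prod N k (fun i => A i j) in
  let H := hadam m P alpha in
  (hnc inL nrm (mat_app N Abig) <= hnc inL nrm (mat_app N H) /\
   hnc inL nrm (mat_app N H)
     <= Rprod m (fun j => hpow (hnc inL nrm (mat_app N (P j))) (alpha j))) /\
  (rho_ess inL nrm (mat_app N Abig) <= rho_ess inL nrm (mat_app N H) /\
   rho_ess inL nrm (mat_app N H)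
     <= Rprod m (fun j => hpow (rho_ess inL nrm (mat_app N (P j))) (alpha j))).
Proof.
  intros HL Hoc _ _ HA Ha Hs Abig P H.
  assert (HP : forall j, (j < m)%nat -> opmat N inL (P j))
    by (intros; eapply opmat_prod; eauto; intros; now apply HA).
  assert (HH : opmat N inL H) by (eapply opmat_hadam; eauto).
  assert (HAbig : opmat N inL Abig).
  { eapply opmat_prod; eauto. intros i Hi. eapply opmat_hadam; eauto. intros j Hj.
    now apply HA. }
  assert (Hle : forall i j, domb N i = true -> domb N j = true -> Abig i j <= H i j)
    by (eapply mat_prod_hadam_le; eauto).
  (* Between nonnegative matrices the entrywise inequality is domination of operators, so both
     left-hand inequalities reduce to monotonicity. *)
  destruct (opmat_le N inL nrm HL Abig H (proj1 HAbig) HH Hle) as [_ Hdom].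
  assert (HbA : is_bop inL nrm (mat_app N Abig)) by (eapply opmat_bop; eauto).
  assert (HbH : is_bop inL nrm (mat_app N H)) by (eapply opmat_bop; eauto).
  split; split.
  - now apply (hnc_mono N inL nrm).
  - now apply (hnc_hadam N inL nrm).
  - apply (rho_ess_mono N inL nrm); trivial. now apply (opmat_opdom N inL nrm).
  - now apply (rho_ess_hadam N inL nrm).
Qed.
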